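(* Let $T$ be a complete local theory in the sort $D$. Assume $T$ has an orbit-bounded model in which every $2$-ball is contained in a union of finitely many $1$-balls. Then: (1) A core for $T$ exists and is unique up to isomorphism. Denote it $\mathcal{J}$. (2) (Reflection) Let $\Theta$ be a universal sentence $(\forall p_1,\ldots,p_k)R$, where $R$ is an arbitrary Boolean combination of local pp formulas in the pattern language $\mathcal{L}$. Let $M$ be an orbit-bounded model of $T$. If $S(M)\models\Theta$ then $\mathcal{J}\models\Theta$. (3) (Quantifier elimination) $\mathcal{L}$-atomic types in $\mathcal{J}$ are orbits of $\mathrm{Aut}(\mathcal{J})$ (i.e. two finite tuples of $\mathcal{J}$ satisfy the same atomic $\mathcal{L}$-formulas iff they are conjugate under $\mathrm{Aut}(\mathcal{J})$). Every local pp formula is equivalent (in any $S(M)$, $M\models T$, as well as in $\mathcal{J}$) to a certain (possibly infinite) conjunction of atomic formulas. (4) $\mathrm{Aut}(\mathcal{J})$ has a natural locally compact topology, whose (pre-)basic closed sets are the sets $$W(t;a,b)=\{g\in\mathrm{Aut}(\mathcal{J}): \mathcal{J}\models \mathsf{Def}_t(ga_1,\ldots,ga_n,b_1,\ldots,b_m)\}$$ for $\mathsf{Def}_t$ a basic relation of $\mathcal{L}$ and $a_1,\dots,a_n,b_1,\dots,b_m\in\mathcal{J}$. The canonical Hausdorff quotient $\mathcal{G}(T):=\mathrm{Aut}(\mathcal{J})/\mathfrak{g}$ is a locally compact topological group.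
   Context: Local theories. Fix a first-order language $L$ with a sort $D$ (treated as the only sort) and a reflexive symmetric binary relation $m_1$ on $D$ in $L$. Let $d_m(x,y)$ be the Cayley-graph distance of $m_1$: $d_m(x,y)\le 1$ iff $m_1(x,y)$, and $d_m(x,y)\le n+1$ iff there is $z$ with $d_m(x,z)\le 1$, $d_m(z,y)\le n$. Write $m_n(x,y)$ for $d_m(x,y)\le n$, and $m_n(a)=\{y: m_n(a,y)\}$ for the $n$-ball around $a$. A local formula is one in which all quantifiers are local (bounded), i.e. of the form $(\exists x)(m_1(x,y)\wedge\cdots)$ or the dual, $y$ another variable. A local theory $T$ is considered only through its local models: structures satisfying $T$ in which any two elements of $D$ are at finite $d_m$-distance (elementary extensions are also understood to be local, and elementarity is with respect to local formulas). $T$ is complete if it decides all sentences $(\forall x)\phi$ and $(\exists x)\phi$ with $\phi$ local. A model $M$ is orbit-bounded if for some $k\in\mathbb{N}$, for all $a,b\in D(M)$ there is $\alpha\in\mathrm{Aut}(M)$ with $d_m(a,\alpha(b))\le k$. Type spaces and the pattern language. For $M\models T$, $S(M)=S_D(M)$ is the set of complete $1$-types (of local formulas) over $M$ in a variable $x$ of sort $D$ that are realized in some local elementary extension of $M$. The pattern language $\mathcal{L}$ is one-sorted and relational, with equality; for each tuple $t=(\phi_1,\ldots,\phi_n;\alpha)$ with $\phi_i(x_i,y)$ and $\alpha(y)$ local $L$-formulas without parameters ($x_i$ a single variable, $y$ a tuple of variables) it has an $n$-ary relation symbol $\mathsf{Def}_t$. $S(M)$ is an $\mathcal{L}$-structure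 via $$\mathsf{Def}_t^{S(M)}=\Big\{(p_1,\ldots,p_n)\in S(M)^n: (\forall a\in\alpha(M))\ \bigvee_{i\le n}\phi_i(x,a)\in p_i\Big\}.$$ The locality relation of $\mathcal{L}$ is $\mu_1(\xi_1,\xi_2):=\mathsf{Def}_t$ with $t=(\neg m_1(x_1,y_1),\neg m_1(x_2,y_2);\neg m_5(y_1,y_2))$. A local pp formula of $\mathcal{L}$ is one built from atomic formulas using conjunction and local existential quantification $(\exists \xi)(\mu_1(\xi,\eta)\wedge\phi)$, with $\eta$ another variable or a constant. Homomorphisms and embeddings (isomorphisms onto the image) are of $\mathcal{L}$-structures. Core. A core for $T$ is an $\mathcal{L}$-structure $J$ such that (a) for any orbit-bounded $M\models T$ there is an $\mathcal{L}$-embedding $j:J\to S(M)$; (b) for any such $j$ there is a homomorphism $r:S(M)\to J$ with $r\circ j=\mathrm{Id}_J$. The pp topology on $\mathcal{J}$ is the coarsest topology in which every subset of $\mathcal{J}$ defined by a local pp formula with parameters is closed. The subgroup of infinitesimal automorphisms is $\mathfrak{g}=\{g\in\mathrm{Aut}(\mathcal{J}): gU\cap U\ne\emptyset \text{ for every nonempty open } U\subset\mathcal{J}\}$; $\mathrm{Aut}(\mathcal J)/\mathfrak g$ has the quotient topology. ''Locally compact'' for $\mathrm{Aut}(\mathcal{J})$ means every point has a compact neighborhood (Hausdorff is not presupposed).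
   Formalization: A core is also required to have every homomorphism J→S(M), M orbit-bounded, an embedding (with (a),(b) alone uniqueness fails); function symbols of positive arity must take values within bounded distance of one of their arguments (for arbitrary functions a core may not exist). *)

(* Defs.v *)
From HB Require Import structures.
From mathcomp Require Import all_boot all_order finmap all_classical generic_quotient.
From mathcomp Require Import topology separation_axioms.

Set Implicit Arguments.
Unset Strict Implicit.
Unset Printing Implicit Defensive.

Local Open Scope classical_set_scope.
Local Open Scope group_scope.

(** * Local logic *)

(* The distinguished symbol m_1 is not listed in [rsym]: it is built into
   structures ([m1]) and formulas ([FM1]). *)
Record language := Language {
  fsym : Type;
  farity : fsym -> nat;
  rsym : Type;
  rarity : rsym -> nat }.

Record structure (L : language) := Structure {
  dom :> Type;
  dom_inh : inhabited dom;
  fint : forall f : fsym L, ('I_(farity f) -> dom) -> dom;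
  rint : forall r : rsym L, ('I_(rarity r) -> dom) -> Prop;
  m1 : dom -> dom -> Prop;
  m1_refl : forall x, m1 x x;
  m1_sym : forall x y, m1 x y -> m1 y x }.

Inductive term (L : language) (n : nat) : Type :=
| Var : 'I_n -> term L n
| App : forall f : fsym L, ('I_(farity f) -> term L n) -> term L n.
Arguments Var {L n}.

(* [fml L n] is the type of local formulas in n free variables: the only
   quantifier is [FEx i phi], the local quantifier (exists x)(m_1(x, x_i) /\ phi),
   which binds variable 0 of phi and shifts the others by one.  Negation,
   the other connectives and the dual quantifier are classically definable. *)
Inductive fml (L : language) : nat -> Type :=
| FFalse n : fml L n
| FEq n : term L n -> term L n -> fml L n
| FM1 n : term L n -> term L n -> fml L n
| FRel n (r : rsym L) : ('I_(rarity r) -> term L n) -> fml L n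
| FImp n : fml L n -> fml L n -> fml L n
| FEx n : 'I_n -> fml L n.+1 -> fml L n.
Arguments FFalse {L n}.

Definition FNot L n (phi : fml L n) : fml L n := FImp phi FFalse.

Definition scons {X : Type} {n : nat} (x : X) (s : 'I_n -> X) : 'I_n.+1 -> X :=
  fun i => if unlift ord0 i is Some j then s j else x.

Fixpoint eval L (M : structure L) n (s : 'I_n -> M) (t : term L n) : M :=
  match t with
  | Var i => s i
  | App f args => fint (fun i => eval s (args i))
  end.

Fixpoint sat L (M : structure L) n (phi : fml L n) : ('I_n -> M) -> Prop :=
  match phi with
  | FFalse _ => fun _ => False
  | FEq _ t u => fun s => eval s t = eval s u
  | FM1 _ t u => fun s => m1 (eval s t) (eval s u)
  | FRel _ r args => fun s => rint (fun i => eval s (args i))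
  | FImp _ phi psi => fun s => sat phi s -> sat psi s
  | FEx _ i phi => fun s => exists x, m1 x (s i) /\ sat phi (scons x s)
  end.

(* [ball k x] is m_k(x), the set of points at m_1-distance at most k from x. *)
Fixpoint ball L (M : structure L) (k : nat) (x : M) : set M :=
  match k with
  | 0 => [set x]
  | k'.+1 => [set y | exists z, m1 x z /\ ball k' z y]
  end.

Fixpoint ball_fml L (k n : nat) (i j : 'I_n) : fml L n :=
  match k with
  | 0 => FEq (Var i) (Var j)
  | 1 => FM1 (Var i) (Var j)
  | k'.+1 => FEx i (ball_fml L k' ord0 (lift ord0 j))
  end.

Definition local_structure L (M : structure L) :=
  forall x y : M, exists k, ball k x y.

(* The sentences (forall x) phi and (exists x) phi with phi local. *)
Inductive lsentence (L : language) : Type :=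
| SAll : fml L 1 -> lsentence L
| SEx : fml L 1 -> lsentence L.

Definition holds L (M : structure L) (sigma : lsentence L) : Prop :=
  match sigma with
  | SAll phi => forall x : M, sat phi (fun=> x)
  | SEx phi => exists x : M, sat phi (fun=> x)
  end.

Definition theory (L : language) := set (lsentence L).

Definition local_model L (T : theory L) (M : structure L) :=
  local_structure M /\ forall sigma, T sigma -> holds M sigma.

Definition complete L (T : theory L) := forall sigma : lsentence L,
  (forall M, local_model T M -> holds M sigma) \/
  (forall M, local_model T M -> ~ holds M sigma).

(* Vacuous for relational languages.  In local logic the value of a function
   symbol must stay close to its arguments: otherwise f(x) being at finite
   distance from x is an infinitary constraint on local structures, and
   compactness fails. *)
Definition bounded_functions L (T : theory L) :=
  forall f : fsym L, 0 < farity f ->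
    exists k, forall M, local_model T M ->
      forall s : 'I_(farity f) -> M, exists i, ball k (s i) (fint s).

Definition automorphism L (M : structure L) (alpha : M -> M) :=
  [/\ bijective alpha,
      forall (f : fsym L) (s : 'I_(farity f) -> M),
        alpha (fint s) = fint (alpha \o s),
      forall (r : rsym L) (s : 'I_(rarity r) -> M),
        rint s <-> rint (alpha \o s) &
      forall x y : M, m1 x y <-> m1 (alpha x) (alpha y)].

Definition orbit_bounded L (M : structure L) :=
  exists k, forall a b : M,
    exists2 alpha, automorphism alpha & ball k a (alpha b).

Definition finite_covers L (M : structure L) := forall x : M,
  exists2 C : set M, finite_set C & ball 2 x `<=` \bigcup_(c in C) ball 1 c.

(* Elementarity is with respect to local formulas only. *)
Definition elementary L (M N : structure L) (f : M -> N) :=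
  forall n (phi : fml L n) (s : 'I_n -> M), sat phi s <-> sat phi (f \o s).

(** * Type spaces and the pattern language *)

(* A set of formulas phi(x, a) with parameters a in M; x is variable 0. *)
Definition formula_set L (M : structure L) :=
  forall m, fml L m.+1 -> ('I_m -> M) -> Prop.

Definition type_of L (M N : structure L) (f : M -> N) (b : N) : formula_set M :=
  fun m phi a => sat phi (scons b (f \o a)).

Definition complete_type L (M : structure L) := {p : formula_set M |
  exists (N : structure L) (f : M -> N) (b : N),
    [/\ local_structure N, elementary f & p = type_of f b]}.

(* The index t = (phi_1, ..., phi_n; alpha) of a relation symbol Def_t;
   in phi_i(x_i, y), variable 0 is x_i and the others are y. *)
Record pattern (L : language) := Pattern {
  parity : nat;
  pparams : nat;
  pphi : 'I_parity -> fml L pparams.+1;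
  palpha : fml L pparams }.

Record pstruct (L : language) := PStruct {
  pdom :> Type;
  Def : forall t : pattern L, ('I_(parity t) -> pdom) -> Prop }.

Definition type_space L (M : structure L) : pstruct L :=
  @PStruct L (complete_type M) (fun t p =>
    forall a : 'I_(pparams t) -> M, sat (palpha t) a ->
      exists i, sval (p i) _ (pphi i) a).

Definition mu1_pattern (L : language) : pattern L :=
  @Pattern L 2 2
    (fun i : 'I_2 => FNot (FM1 (Var ord0) (Var (lift ord0 i))))
    (FNot (ball_fml L 5 ord0 ord_max)).

Definition mu1 L (J : pstruct L) (p q : J) : Prop :=
  Def (t := mu1_pattern L) (scons p (fun=> q)).

Inductive atom (L : language) (n : nat) : Type :=
| ADef : forall t : pattern L, ('I_(parity t) -> 'I_n) -> atom L n
| AEq : 'I_n -> 'I_n -> atom L n.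

Definition asat L (J : pstruct L) n (gamma : atom L n) (p : 'I_n -> J) : Prop :=
  match gamma with
  | ADef t v => Def (t := t) (p \o v)
  | AEq i j => p i = p j
  end.

(* [PEx i phi] is (exists xi)(mu_1(xi, x_i) /\ phi), binding variable 0 of phi.
   Constants (parameters) are variables whose value is fixed, see [ppdef]. *)
Inductive ppfml (L : language) : nat -> Type :=
| PAtom n : atom L n -> ppfml L n
| PAnd n : ppfml L n -> ppfml L n -> ppfml L n
| PEx n : 'I_n -> ppfml L n.+1 -> ppfml L n.

Fixpoint psat L (J : pstruct L) n (phi : ppfml L n) : ('I_n -> J) -> Prop :=
  match phi with
  | PAtom _ gamma => fun p => asat gamma p
  | PAnd _ phi psi => fun p => psat phi p /\ psat psi p
  | PEx _ i phi => fun p => exists x, mu1 x (p i) /\ psat phi (scons x p)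
  end.

Inductive bppfml (L : language) (n : nat) : Type :=
| BPp : ppfml L n -> bppfml L n
| BNot : bppfml L n -> bppfml L n
| BAnd : bppfml L n -> bppfml L n -> bppfml L n
| BOr : bppfml L n -> bppfml L n -> bppfml L n.

Fixpoint bsat L (J : pstruct L) n (R : bppfml L n) (p : 'I_n -> J) : Prop :=
  match R with
  | BPp phi => psat phi p
  | BNot R => ~ bsat R p
  | BAnd R R' => bsat R p /\ bsat R' p
  | BOr R R' => bsat R p \/ bsat R' p
  end.

(** * Cores *)

Definition phom L (J K : pstruct L) (h : J -> K) :=
  forall (t : pattern L) (p : 'I_(parity t) -> J), Def p -> Def (h \o p).

Definition pembedding L (J K : pstruct L) (h : J -> K) :=
  injective h /\
  forall (t : pattern L) (p : 'I_(parity t) -> J), Def p <-> Def (h \o p).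

Definition pisomorphic L (J K : pstruct L) :=
  exists2 h : J -> K, bijective h & pembedding h.

(* Without [core_rigid] cores are not unique.  If m_1 is total and T says that
   D is infinite, with no further structure, then S(M) consists of the realized
   types and one non-realized type oo; for a realized type a, both {oo} and
   {a, oo} satisfy the other two clauses: a permutation of M fixing a can move
   any finite tuple off the other realized types, so collapsing these to oo is
   a homomorphism. *)
Record is_core L (T : theory L) (J : pstruct L) : Prop := IsCore {
  core_embeds : forall M, local_model T M -> orbit_bounded M ->
    exists j : J -> type_space M, pembedding j;
  core_retract : forall M, local_model T M -> orbit_bounded M ->
    forall j : J -> type_space M, pembedding j ->
      exists2 r : type_space M -> J, phom r & cancel j r;
  core_rigid : forall M, local_model T M -> orbit_bounded M ->
    forall j : J -> type_space M, phom j -> pembedding j }.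

(** * Topological notions *)

(* Hausdorffness is not part of this notion, unlike precompactness in the
   library's [locally_compact], which asks for closed compact neighborhoods. *)
Definition locally_compact_space (X : topologicalType) :=
  forall x : X, exists2 K : set X, nbhs x K & compact K.

#[short(type="preTopologicalGroupType")]
HB.structure Definition PreTopologicalGroup := {G of Topological G & Group G}.

Definition topological_group (G : preTopologicalGroupType) :=
  continuous (fun x : G * G => x.1 * x.2) /\ continuous (fun x : G => x^-1).

(** * The pp topology *)

Definition pptop L (J : pstruct L) : Type := pdom J.

Definition ppdef L (J : pstruct L) : set (set J) :=
  [set X | exists m (phi : ppfml L m.+1) (c : 'I_m -> J),
     X = [set x | psat phi (scons x c)]].

HB.instance Definition _ L (J : pstruct L) := gen_eqMixin (pptop J).
HB.instance Definition _ L (J : pstruct L) := gen_choiceMixin (pptop J).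
HB.instance Definition _ L (J : pstruct L) :=
  @isSubBaseTopological.Build (pptop J) (set (pptop J))
    [set U | ppdef (J := J) (~` U)] id.

(** * The automorphism group *)

Record aut L (J : pstruct L) := Aut {
  autf :> J -> J;
  aut_inv : J -> J;
  aut_invK : cancel aut_inv autf;
  autK : cancel autf aut_inv;
  aut_Def : forall (t : pattern L) (p : 'I_(parity t) -> J),
    Def p <-> Def (autf \o p) }.

Lemma aut_eq L (J : pstruct L) (g h : aut J) : (forall x, g x = h x) -> g = h.
Proof.
case: g => f i fK iK Hf; case: h => f' i' fK' iK' Hf' /= e.
have ef : f = f' by apply: funext.
rewrite -{}ef in fK' iK' Hf' *; clear e.
have ei : i = i' by apply: funext => x; rewrite -{1}(fK' x) iK.
rewrite -{}ei in fK' iK' *.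
by congr Aut; exact: Prop_irrelevance.
Qed.

Section AutGroup.
Variables (L : language) (J : pstruct L).
Implicit Types g h : aut J.

Definition aut1 : aut J.
Proof. by exists id id. Defined.

Definition autM g h : aut J.
Proof.
exists (g \o h) (aut_inv h \o aut_inv g).
- by move=> x /=; rewrite !aut_invK.
- by move=> x /=; rewrite !autK.
- by move=> t p; rewrite (aut_Def h) (aut_Def g).
Defined.

Definition autV g : aut J.
Proof.
exists (aut_inv g) g; [exact: autK | exact: aut_invK |].
move=> t p; rewrite (aut_Def g (aut_inv g \o p)).
by rewrite (_ : _ \o (_ \o p) = p) //; apply: funext => i /=; rewrite aut_invK.
Defined.

HB.instance Definition _ := gen_eqMixin (aut J).
HB.instance Definition _ := gen_choiceMixin (aut J).

Lemma autMA : associative autM.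
Proof. by move=> g h k; exact: aut_eq. Qed.
Lemma aut1M : left_id aut1 autM.
Proof. by move=> g; exact: aut_eq. Qed.
Lemma autM1 : right_id aut1 autM.
Proof. by move=> g; exact: aut_eq. Qed.
Lemma autVM : left_inverse aut1 autV autM.
Proof. by move=> g; apply: aut_eq => x /=; rewrite autK. Qed.
Lemma autMV : right_inverse aut1 autV autM.
Proof. by move=> g; apply: aut_eq => x /=; rewrite aut_invK. Qed.

HB.instance Definition _ :=
  isGroup.Build (aut J) autMA aut1M autM1 autVM autMV.

(* The n first arguments a_i = c_i are moved by g, the remaining arguments
   b_j = c_(n + j) are not. *)
Definition Wset (t : pattern L) (n : nat) (c : 'I_(parity t) -> J) : set (aut J) :=
  [set g | Def (fun i => if i < n then g (c i) else c i)].

HB.instance Definition _ :=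
  @isSubBaseTopological.Build (aut J) (set (aut J))
    [set U | exists t n (c : 'I_(parity t) -> J), ~` U = Wset n c] id.

Definition pp_act g : pptop J -> pptop J := g.

Definition infinitesimal : set (aut J) :=
  [set g | forall U : set (pptop J), open U -> U !=set0 ->
     (pp_act g @` U) `&` U !=set0].

End AutGroup.

Section Infinitesimal.
Variables (L : language) (J : pstruct L).
Implicit Types g h : aut J.

Lemma comp_scons (X Y : Type) n (f : X -> Y) (x : X) (s : 'I_n -> X) :
  f \o scons x s = scons (f x) (f \o s).
Proof. by apply: funext => i /=; rewrite /scons; case: unlift. Qed.

Lemma psat_aut g n (phi : ppfml L n) (p : 'I_n -> J) :
  psat phi p <-> psat phi (g \o p).
Proof.
elim: phi p => {n} [n [t v|i j]|n phi IH psi IH'|n i phi IH] p /=.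
- exact: (aut_Def g (p \o v)).
- by split=> [->//|/(can_inj (@autK _ _ g))].
- by rewrite (IH p) (IH' p).
have mug q q' : mu1 q q' <-> mu1 (g q) (g q').
  by rewrite /mu1 (aut_Def g) comp_scons.
split=> [[x [xp sx]]|[x [xp sx]]].
  by exists (g x); rewrite -comp_scons -IH -mug.
exists (aut_inv g x); split; first by apply/mug; rewrite aut_invK.
by apply/IH; rewrite comp_scons aut_invK.
Qed.

Lemma aut_open g (U : set (pptop J)) : open U -> open (pp_act g @^-1` U).
Proof.
move=> [D sD <-]; exists [set pp_act g @^-1` A | A in D]; last first.
  rewrite eqEsubset; split=> x.
    by move=> [_ [A DA <-] Ax]; exists A.
  by move=> [A DA Ax]; exists (pp_act g @^-1` A) => //; exists A.
move=> _ [A /sD [F sF <-] <-].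
exists [fset pp_act g @^-1` B | B in F]%fset; last first.
  rewrite eqEsubset; split=> x /=.
    by move=> xF B BF; apply: (xF (pp_act g @^-1` B)); apply: in_imfset.
  by move=> xF _ /imfsetP [B BF ->]; exact: xF.
move=> _ /imfsetP [B /= /sF + ->]; rewrite !inE => -[m [phi [c eB]]].
exists m, phi, (aut_inv g \o c).
rewrite -[~` _]/(pp_act g @^-1` (~` B)) eB eqEsubset.
have e x : autf g \o scons x (aut_inv g \o c) = scons (g x) c.
  by rewrite comp_scons; congr scons; apply: funext => i /=; rewrite aut_invK.
by split=> x /=; rewrite (psat_aut g _ (scons x _)) e.
Qed.

Lemma infinitesimal1 : infinitesimal (1 : aut J).
Proof. by move=> U _ [x Ux]; exists x; split=> //; exists x. Qed.

Lemma infinitesimalV g : infinitesimal g -> infinitesimal g^-1.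
Proof.
move=> ig U oU U0; have [_ [[x Ux <-] Ugx]] := ig U oU U0.
by exists x; split=> //; exists (g x) => //=; rewrite autK.
Qed.

Lemma infinitesimalM g h :
  infinitesimal g -> infinitesimal h -> infinitesimal (g * h).
Proof.
move=> ig ih U oU U0; have [_ [[x Ux <-] Uhx]] := ih U oU U0.
pose V := U `&` pp_act h @^-1` U.
(* V is a nonempty open set with V and h V both inside U *)
have oV : open (pp_act h^-1 @^-1` V) by apply/aut_open/openI => //; exact: aut_open.
have [] := ig _ oV; first by exists (h x); rewrite /V /= autK.
move=> _ [[y Vy <-] Vgy]; exists (g y); split.
  exists (aut_inv h y); first by case: Vy.
  by rewrite /pp_act /= aut_invK.
by case: Vgy => _; rewrite /pp_act /= aut_invK.
Qed.

Lemma infinitesimalJ g h : infinitesimal g -> infinitesimal (h^-1 * g * h).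
Proof.
move=> ig U oU [x Ux].
have [] := ig _ (aut_open h^-1 oU); first by exists (h x); rewrite /= autK.
move=> _ [[y Uy <-] Ugy]; exists (h^-1 (g y)); split=> //.
by exists (h^-1 y) => //; rewrite /pp_act /= aut_invK.
Qed.

Definition inf_rel g h : bool := `[< infinitesimal (g^-1 * h) >].

Lemma inf_rel_refl : reflexive inf_rel.
Proof. by move=> g; apply/asboolP; rewrite mulVg; exact: infinitesimal1. Qed.

Lemma inf_rel_sym : symmetric inf_rel.
Proof.
move=> g h; apply: asbool_equiv_eq.
by split=> /infinitesimalV; rewrite invgM invgK.
Qed.

Lemma inf_rel_trans : transitive inf_rel.
Proof.
move=> h g k /asboolP igh /asboolP ihk; apply/asboolP.
by have := infinitesimalM igh ihk; rewrite mulgA mulgK.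
Qed.

Canonical inf_equiv := EquivRel inf_rel inf_rel_refl inf_rel_sym inf_rel_trans.

(* Aut(J)/g with the quotient topology. *)
Definition autquo : Type := quotient_topology {eq_quot inf_equiv}%qT.

HB.instance Definition _ := Topological.on autquo.
HB.instance Definition _ := Quotient.on autquo.

Definition autpi (g : aut J) : autquo := \pi_autquo%qT g.

Lemma autpi_eq g h : autpi g = autpi h <-> infinitesimal (g^-1 * h).
Proof.
rewrite /autpi; split=> [e|i].
  by apply/asboolP; apply/(@eqmodP _ inf_equiv).
by apply/(@eqmodP _ inf_equiv)/asboolP.
Qed.

Lemma autpi_repr (x : autquo) : autpi (repr x) = x.
Proof. exact: reprK. Qed.

Definition autquoM (x y : autquo) : autquo := autpi (repr x * repr y).
Definition autquoV (x : autquo) : autquo := autpi (repr x)^-1.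

Lemma autpiM g h : autquoM (autpi g) (autpi h) = autpi (g * h).
Proof.
apply/autpi_eq; set g' := repr _; set h' := repr _.
have ig : infinitesimal (g'^-1 * g) by apply/autpi_eq; rewrite autpi_repr.
have ih : infinitesimal (h'^-1 * h) by apply/autpi_eq; rewrite autpi_repr.
have := infinitesimalM (infinitesimalJ h' ig) ih.
by rewrite invgM !mulgA mulgK.
Qed.

Lemma autpiV g : autquoV (autpi g) = autpi g^-1.
Proof.
apply/autpi_eq; set g' := repr _; rewrite invgK.
have : infinitesimal (g^-1 * g') by apply/autpi_eq; rewrite autpi_repr.
by move=> /(infinitesimalJ g^-1); rewrite invgK mulgA mulgV mul1g.
Qed.

Lemma autquoMA : associative autquoM.
Proof.
move=> x y z; rewrite -[x]autpi_repr -[y]autpi_repr -[z]autpi_repr.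
by rewrite !autpiM mulgA.
Qed.

Lemma autquo1M : left_id (autpi 1) autquoM.
Proof. by move=> x; rewrite -[x]autpi_repr autpiM mul1g. Qed.

Lemma autquoM1 : right_id (autpi 1) autquoM.
Proof. by move=> x; rewrite -[x]autpi_repr autpiM mulg1. Qed.

Lemma autquoVM : left_inverse (autpi 1) autquoV autquoM.
Proof. by move=> x; rewrite -[x]autpi_repr autpiV autpiM mulVg. Qed.

Lemma autquoMV : right_inverse (autpi 1) autquoV autquoM.
Proof. by move=> x; rewrite -[x]autpi_repr autpiV autpiM mulgV. Qed.

HB.instance Definition _ :=
  isGroup.Build autquo autquoMA autquo1M autquoM1 autquoVM autquoMV.

End Infinitesimal.

(* Main.v *)
(* For M orbit-bounded, the facts Def_t(p_1, ..., p_n) true in S(M) are closed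
   under eliminating one point: the existence of q near p_0 with finitely many
   prescribed relations to p_1, ..., p_n is itself a relation Def_t' of the p_i.
   With the compactness of balls in S(M) this gives quantifier elimination for pp
   formulas and, by Zorn, injectivity: a partial homomorphism from S(M) to S(N)
   extends to all of S(M).  The core is a subset J of S(M) maximal for the
   property that every homomorphism J -> S(M) is an embedding; the image of a
   homomorphism S(M) -> S(M) fixing J and satisfying a maximal set of facts has
   this property too, so it equals J, which is therefore a retract.
     Endomorphisms of J are automorphisms, and bounded families of automorphisms
   have limits along ultrafilters, even jointly: a family of pairs (g_i, h_i) has
   a limit (g, h) respecting every relation between g_i and h_i.  This yields
   local compactness, and, as limits in the quotient by the infinitesimals are
   unique, the joint continuity of multiplication there. *)
Require Import Defs.
From mathcomp Require Import all_boot all_order finmap all_classical generic_quotient.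
From mathcomp Require Import topology separation_axioms.
(* [eval] and [ball] are those of Defs, not of mathcomp. *)
Import Defs.

Set Implicit Arguments.
Unset Strict Implicit.
Unset Printing Implicit Defensive.

Local Open Scope classical_set_scope.

(** * Local formulas *)

(** Orbit-boundedness makes the number and the spread of the covering 1-balls the same at every
    point, so the cover becomes one sentence, which completeness carries to all local models.
    Consequently every type over a model M contains m_1(x, c) for some c in M, and whatever is asked
    of a point close to a given one can be asked inside a fixed ball of M. This keeps the
    eliminating formula local and reduces infinitely many demands to the compactness of one ball.
    Orbit-boundedness is used once more, for the first point: nothing placed earlier bounds where
    its value may lie. Later points are reached along chains of mu_1, hence the connectedness
    conditions in the extension statements. These are stated for a family of maps and a filter, so
    that one argument yields homomorphisms, upper bounds of chains and limits of automorphisms. *)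

Section Scons.
Variables (X : Type) (n : nat).
Implicit Types (x : X) (s : 'I_n -> X).

Lemma scons0 x s : scons x s ord0 = x.
Proof. by rewrite /scons unlift_none. Qed.

Lemma sconsS x s i : scons x s (lift ord0 i) = s i.
Proof. by rewrite /scons liftK. Qed.

Lemma scons_eta (u : 'I_n.+1 -> X) : scons (u ord0) (fun i => u (lift ord0 i)) = u.
Proof.
by apply: funext => i; case: (unliftP ord0 i) => [j|] ->; rewrite ?scons0 ?sconsS.
Qed.

End Scons.

Section Formulas.
Variable L : language.
Implicit Types M N : structure L.

Definition FTrue n : fml L n := FNot FFalse.
Definition FAnd n (phi psi : fml L n) : fml L n := FNot (FImp phi (FNot psi)).
Definition FOr n (phi psi : fml L n) : fml L n := FImp (FNot phi) psi.
Definition FOrs n k (phi : 'I_k -> fml L n) : fml L n :=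
  foldr (fun i => FOr (phi i)) FFalse (enum 'I_k).

Lemma sat_not M n (phi : fml L n) (s : 'I_n -> M) : sat (FNot phi) s <-> ~ sat phi s.
Proof. by []. Qed.

Lemma sat_and M n (phi psi : fml L n) (s : 'I_n -> M) :
  sat (FAnd phi psi) s <-> sat phi s /\ sat psi s.
Proof.
split=> [h|[? ?]] /=; last by apply.
by split; apply: contrapT => ?; apply: h => //= ? ?.
Qed.

Lemma sat_or M n (phi psi : fml L n) (s : 'I_n -> M) :
  sat (FOr phi psi) s <-> sat phi s \/ sat psi s.
Proof.
split=> /= [h|[h /(_ h)//|//]].
by have [?|/h] := pselect (sat phi s); [left|right].
Qed.

Lemma sat_ors M n k (phi : 'I_k -> fml L n) (s : 'I_n -> M) :
  sat (FOrs phi) s <-> exists i, sat (phi i) s.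
Proof.
transitivity (exists2 i, i \in enum 'I_k & sat (phi i) s); last first.
  by split=> [[i _ si]|[i si]]; exists i; rewrite ?mem_enum.
rewrite /FOrs; elim: (enum _) => [|i e IH]; first by split=> // -[].
split=> [/sat_or[si|/IH[j je sj]]|[j]].
- by exists i => //; exact: mem_head.
- by exists j => //; rewrite in_cons je orbT.
by rewrite in_cons sat_or IH => /orP[/eqP<-|je] sj; [left|right; exists j].
Qed.

Fixpoint tren n m (r : 'I_n -> 'I_m) (t : term L n) : term L m :=
  match t with
  | Var i => Var (r i)
  | App f args => App (fun i => tren r (args i))
  end.

Definition shift n m (r : 'I_n -> 'I_m) : 'I_n.+1 -> 'I_m.+1 :=
  scons ord0 (fun i => lift ord0 (r i)).

Fixpoint fren n (phi : fml L n) : forall m, ('I_n -> 'I_m) -> fml L m :=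
  match phi with
  | FFalse _ => fun m _ => FFalse
  | FEq _ t u => fun m r => FEq (tren r t) (tren r u)
  | FM1 _ t u => fun m r => FM1 (tren r t) (tren r u)
  | FRel _ s args => fun m r => FRel (fun i => tren r (args i))
  | FImp _ phi psi => fun m r => FImp (fren phi r) (fren psi r)
  | FEx _ i phi => fun m r => FEx (r i) (fren phi (shift r))
  end.

Lemma eval_ren M n m (r : 'I_n -> 'I_m) (t : term L n) (s : 'I_m -> M) :
  eval s (tren r t) = eval (s \o r) t.
Proof.
by elim: t => //= f args IH; congr fint; apply: funext => i; exact: IH.
Qed.

Lemma scons_shift X n m (r : 'I_n -> 'I_m) (x : X) (s : 'I_m -> X) :
  scons x s \o shift r = scons x (s \o r).
Proof.
apply: funext => i; rewrite /shift /=.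
by case: (unliftP ord0 i) => [j|] ->; rewrite ?scons0 ?sconsS // scons0.
Qed.

Lemma sat_ren M n (phi : fml L n) m (r : 'I_n -> 'I_m) (s : 'I_m -> M) :
  sat (fren phi r) s <-> sat phi (s \o r).
Proof.
elim: phi m r s => {n} [n|n t u|n t u|n q args|n phi IH psi IH'|n i phi IH] m r s /=.
- by [].
- by rewrite !eval_ren.
- by rewrite !eval_ren.
- by under [fun i => eval s _]eq_fun do rewrite eval_ren.
- by rewrite IH IH'.
by split=> -[x [xs sx]]; exists x; split=> //; move: sx; rewrite IH scons_shift.
Qed.

Lemma automorphism_elementary M (alpha : M -> M) :
  automorphism alpha -> elementary alpha.
Proof.
case=> [[beta aK bK] af ar am] n.
have ev k (t : term L k) (s : 'I_k -> M) : eval (alpha \o s) t = alpha (eval s t).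
  elim: t => //= f args IH; rewrite af; congr fint.
  by apply: funext => i; exact: IH.
elim=> {n} [n|n t u|n t u|n q args|n phi IH psi IH'|n i phi IH] s /=.
- by [].
- by rewrite !ev; split=> [->//|/(can_inj aK)].
- by rewrite !ev -am.
- by under [fun i => eval (alpha \o s) _]eq_fun do rewrite ev; rewrite -ar.
- by rewrite IH IH'.
split=> -[x [xs sx]].
  by exists (alpha x); rewrite -am -comp_scons -IH.
exists (beta x); rewrite IH comp_scons bK; split=> //.
by apply/am; rewrite bK.
Qed.

Section Balls.
Variable M : structure L.
Implicit Types x y z : M.

Lemma ball1E x y : ball 1 x y <-> m1 x y.
Proof. by split=> [[z [xz ->//]]|xy]; exists y. Qed.

Lemma ballD k l x y z : ball k x y -> ball l y z -> ball (k + l)%N x z.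
Proof.
elim: k x => [x ->//|k IH x [w [xw wy]] yz].
by exists w; split=> //; exact: IH.
Qed.

Lemma ball_sym k x y : ball k x y -> ball k y x.
Proof.
elim: k x => [x //|k IH x [w [xw wy]]].
rewrite -addn1; apply: ballD (IH _ wy) _.
by apply/ball1E; exact: m1_sym.
Qed.

Lemma ballxx k x : ball k x x.
Proof. by elim: k => // k IH; exists x; split=> //; exact: m1_refl. Qed.

Lemma ballW k l x y : (k <= l)%N -> ball k x y -> ball l x y.
Proof. by move=> /subnKC <- xy; apply: ballD xy (ballxx _ _). Qed.

Lemma sat_ball k n (i j : 'I_n) (s : 'I_n -> M) :
  sat (ball_fml L k i j) s <-> ball k (s i) (s j).
Proof.
elim: k n i j s => // -[|k] IH n i j s; first by rewrite ball1E.
change (sat (ball_fml L k.+2 i j) s) with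
  (exists x, m1 x (s i) /\ sat (ball_fml L k.+1 ord0 (lift ord0 j)) (scons x s)).
split=> -[x [xi]].
  by rewrite IH scons0 sconsS => xj; exists x; split=> //; exact: m1_sym.
by move=> xj; exists x; rewrite IH scons0 sconsS; split=> //; exact: m1_sym.
Qed.

End Balls.

Lemma elementary_ball M N (f : M -> N) k (x y : M) : elementary f ->
  ball k (f x) (f y) <-> ball k x y.
Proof.
move=> fe; pose s (i : 'I_2) : M := scons x (fun=> y) i.
have := fe _ (ball_fml L k ord0 ord_max) s.
have -> : ord_max = lift ord0 ord0 :> 'I_2 by apply: val_inj.
by rewrite !sat_ball /= /s scons0 sconsS => ->.
Qed.

(* [bex k i phi] is (exists x)(m_k(x_i, x) /\ phi). *)
Fixpoint bex k n (i : 'I_n) (phi : fml L n.+1) : fml L n :=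
  match k with
  | 0 => fren phi (scons i id)
  | k.+1 => FEx i (bex k ord0 (fren phi (shift (lift ord0))))
  end.

Lemma sat_bex k n (i : 'I_n) (phi : fml L n.+1) M (s : 'I_n -> M) :
  sat (bex k i phi) s <-> exists x, ball k (s i) x /\ sat phi (scons x s).
Proof.
elim: k n i phi s => [|k IH] n i phi s /=.
  by rewrite sat_ren comp_scons; split=> [?|[x [->]]//]; exists (s i).
have e x y : scons x (scons y s) \o shift (lift ord0) = scons x s.
  by rewrite scons_shift; congr scons; apply: funext => j /=; rewrite sconsS.
split=> [[y [yi /IH[x []]]]|[x [[y [iy yx]] sx]]].
  rewrite scons0 sat_ren e => yx sx; exists x; split=> //.
  by exists y; split=> //; exact: m1_sym.
exists y; split; first exact: m1_sym.
by apply/IH; exists x; rewrite scons0 sat_ren e.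
Qed.

(** A sentence has a single unbounded quantifier. To speak of a tuple, its last entry serves as a
    centre and the others are quantified within distance R of it. *)
Fixpoint bexs R m : fml L m.+1 -> fml L 1 :=
  match m with
  | 0 => id
  | m.+1 => fun phi => bexs R (bex R ord_max phi)
  end.

Lemma sat_bexs R m (phi : fml L m.+1) M (z : M) :
  sat (bexs R phi) (fun=> z) <->
  exists u : 'I_m.+1 -> M,
    [/\ u ord_max = z, forall i, ball R z (u i) & sat phi u].
Proof.
elim: m phi => [|m IH] phi /=.
  split=> [sz|[u [uz _ su]]].
    by exists (fun=> z); split=> // i; exact: ballxx.
  rewrite (_ : (fun=> z) = u) //; apply: funext => i.
  by rewrite -uz; congr u; apply: val_inj; rewrite /= [i]ord1.
have em : ord_max = lift ord0 ord_max :> 'I_m.+2 by apply: val_inj.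
rewrite IH; split=> -[u [uz ub]].
  move/sat_bex => [x [xb sx]]; exists (scons x u); split=> //.
    by rewrite em sconsS.
  move=> i; case: (unliftP ord0 i) => [j|] ->; rewrite ?scons0 ?sconsS //.
  by rewrite -uz.
move=> su; exists (fun i => u (lift ord0 i)); split=> //; first by rewrite -em.
by apply/sat_bex; exists (u ord0); rewrite -em uz scons_eta.
Qed.

End Formulas.

(** * Local ultrapowers *)

Lemma filter_forall_ord (I : Type) (F : set_system I) n (P : 'I_n -> set I)
    {FF : Filter F} : (forall k, F (P k)) -> F [set i | forall k, P k i].
Proof.
elim: n P => [|n IH] P FP.
  by rewrite (_ : mkset _ = setT); [exact: filterT|apply/seteqP; split=> i // _ []].
apply: filterS (filterI (FP ord0) (IH _ (fun k => FP (lift ord0 k)))) => i [P0 PS] k.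
by case: (unliftP ord0 k) => [j|] ->.
Qed.

Lemma cid_eq (T : Type) (P Q : T -> Prop) (hP : exists x, P x) (hQ : exists x, Q x) :
  P = Q -> sval (cid hP) = sval (cid hQ).
Proof. by move=> e; subst Q; rewrite (Prop_irrelevance hP hQ). Qed.

Lemma sig_eq (U : Type) (P : U -> Prop) (x y : {x | P x}) : sval x = sval y -> x = y.
Proof.
case: x y => [x hx] [y hy] /= e; subst y; congr exist; exact: Prop_irrelevance.
Qed.

Section Ultrapower.
Variables (L : language) (M : structure L).
Hypothesis M_bounded : forall f : fsym L, 0 < farity f ->
  exists k, forall s : 'I_(farity f) -> M, exists i, ball k (s i) (fint s).
Hypothesis M_local : local_structure M.
Variables (I : Type) (U : set_system I) (c : M).
Context {UU : UltraFilter U}.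

Let aeq (g h : I -> M) := U [set i | g i = h i].
Let near_c (g : I -> M) := exists k, U [set i | ball k c (g i)].

Let aeqxx g : aeq g g.
Proof. by rewrite /aeq (_ : mkset _ = setT); [exact: filterT|apply/seteqP]. Qed.

Let aeq_class g h : aeq g h -> aeq ^~ g = aeq ^~ h.
Proof.
move=> gh; apply: funext => k; apply: propext.
by split=> H; apply: filterS (filterI H gh) => i /= [-> ->].
Qed.

(** One representative is chosen per class of almost equal functions, so that almost equal points
    become equal without a quotient type. *)
Let canon g := sval (cid (ex_intro (aeq ^~ g) g (aeqxx g))).

Let canonP g : aeq (canon g) g.
Proof. by rewrite /canon; case: cid. Qed.

Let canon_eq g h : aeq g h -> canon g = canon h.
Proof. by move=> gh; apply: cid_eq; exact: aeq_class. Qed.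

Let D := {g : I -> M | near_c g /\ canon g = g}.

Let cls_subproof g : near_c g -> near_c (canon g) /\ canon (canon g) = canon g.
Proof.
move=> [k gk]; split; last exact/canon_eq/canonP.
by exists k; apply: filterS (filterI gk (canonP g)) => i /= [? ->].
Qed.

Let cls g (gc : near_c g) : D := exist _ (canon g) (cls_subproof gc).

Let D_eq (x y : D) : aeq (sval x) (sval y) -> x = y.
Proof.
move=> xy; apply: sig_eq.
by rewrite -(proj2 (svalP x)) -(proj2 (svalP y)); exact: canon_eq.
Qed.

(** A constant has the same value at every index, at finite distance from [c]; otherwise the value
    stays within a fixed distance of some argument. *)
Let near_fint f (s : 'I_(farity f) -> D) : near_c (fun i => fint (fun k => sval (s k) i)).
Proof.
have [f0|f0] := posnP (farity f).
  have [c1 e] : exists c1, forall i, fint (fun k => sval (s k) i) = c1.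
    have [i0 _] := filter_ex (@filterT _ U _).
    exists (fint (fun k => sval (s k) i0)) => i; congr fint.
    by apply: funext => k; have := ltn_ord k; rewrite [X in (_ < X)%N]f0.
  have [k ck] := M_local c c1; exists k.
  by apply: filterS (@filterT _ U _) => i _ /=; rewrite e.
have [k kP] := M_bounded f0.
pose K j := sval (cid (proj1 (svalP (s j)))).
have KP j : U [set i | ball (K j) c (sval (s j) i)] by rewrite /K; case: cid.
exists (\max_j K j + k)%N.
apply: filterS (filter_forall_ord KP) => i Ki.
have [j jP] := kP (fun k => sval (s k) i).
by apply: ballD jP; apply: ballW (Ki j); exact: leq_bigmax.
Qed.

Let near_cst x : near_c (fun=> x).
Proof.
have [k xk] := M_local c x; exists k.
by apply: filterS (@filterT _ U _).
Qed.

Let m1_reflD (x : D) : U [set i | m1 (sval x i) (sval x i)].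
Proof. by apply: filterS (@filterT _ U _) => i _; exact: m1_refl. Qed.

Let m1_symD (x y : D) :
  U [set i | m1 (sval x i) (sval y i)] -> U [set i | m1 (sval y i) (sval x i)].
Proof. by apply: filterS => i; exact: m1_sym. Qed.

(* The part of the ultrapower of M at finite distance from the diagonal. *)
Definition ultrapower : structure L :=
  @Structure L D (inhabits (cls (near_cst c)))
    (fun f s => cls (near_fint s))
    (fun r s => U [set i | rint (fun k => sval (s k) i)])
    (fun x y => U [set i | m1 (sval x i) (sval y i)])
    m1_reflD m1_symD.

Lemma eval_ultrapower n (t : term L n) (s : 'I_n -> ultrapower) :
  U [set i | sval (eval s t) i = eval (fun k => sval (s k) i) t].
Proof.
elim: t => [j|f args IH] /=; first exact: aeqxx.
have := canonP (fun i => fint (fun k => sval (eval s (args k)) i)).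
move=> /(filterI (filter_forall_ord IH)); apply: filterS => i /= [e ->].
by congr fint; apply: funext => k; rewrite e.
Qed.

Theorem los n (phi : fml L n) (s : 'I_n -> ultrapower) :
  sat phi s <-> U [set i | sat phi (fun k => sval (s k) i)].
Proof.
elim: phi s => {n} [n|n t u|n t u|n r args|n phi IH psi IH'|n j phi IH] s /=.
- by split=> // /filter_ex[].
- have ht := eval_ultrapower t s; have hu := eval_ultrapower u s.
  split=> [e|e].
    by apply: filterS (filterI ht hu) => i /= [<- <-]; rewrite e.
  by apply: D_eq; apply: filterS (filterI (filterI ht hu) e) => i /= [[-> ->]].
- have ht := eval_ultrapower t s; have hu := eval_ultrapower u s.
  by split=> e; apply: filterS (filterI (filterI ht hu) e) => i /= [[-> ->]].
- have h : U [set i | forall k, sval (eval s (args k)) i =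
      eval (fun k0 => sval (s k0) i) (args k)].
    by apply: filter_forall_ord => k; exact: eval_ultrapower.
  change (U [set i | rint (fun k => sval (eval s (args k)) i)] <->
    U [set i | rint (fun k => eval (fun k => sval (s k) i) (args k))]).
  by split=> e; apply: filterS (filterI h e) => i /= [E]; rewrite (funext E).
- rewrite IH IH'; split=> [h|h hp].
    have [/h|] := in_ultra_setVsetC [set i | sat phi (fun k => sval (s k) i)] UU.
      by apply: filterS => i /=.
    by apply: filterS => i /=.
  by apply: filterS (filterI h hp) => i /= [h1 /h1].
have E (x : D) i : (fun k => sval (scons x s k) i) =
    scons (sval x i) (fun k => sval (s k) i).
  by apply: funext => k; rewrite /scons; case: unlift.
split=> [[x [xj /IH sx]]|h].
  by apply: filterS (filterI xj sx) => i /= [? ]; rewrite E; exists (sval x i).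
have /choice[w wP] : forall i, exists x : M,
    (exists x, m1 x (sval (s j) i) /\ sat phi (scons x (fun k => sval (s k) i))) ->
    m1 x (sval (s j) i) /\ sat phi (scons x (fun k => sval (s k) i)).
  move=> i; case: (pselect (exists x, m1 x (sval (s j) i) /\
    sat phi (scons x (fun k => sval (s k) i)))) => [[x ?]|?]; first by exists x.
  by exists c.
(* A local witness lies within distance 1 of [s j], so it stays near [c]: the theorem survives the
   restriction to the local part because quantifiers are local. *)
have nw : near_c w.
  have [k kP] := proj1 (svalP (s j)); exists (k + 1)%N.
  apply: filterS (filterI h kP) => i /= [/wP[wi _] ck].
  by apply: ballD ck _; apply/ball1E; exact: m1_sym.
exists (cls nw); rewrite IH.
split; apply: filterS (filterI h (canonP w)) => i /= [/wP[h1 h2] e].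
  by rewrite e.
by rewrite E /= e.
Qed.

Lemma ultrapower_local : local_structure ultrapower.
Proof.
move=> x y; have [k xk] := proj1 (svalP x); have [l yl] := proj1 (svalP y).
exists (k + l)%N; pose s (i : 'I_2) : ultrapower := scons x (fun=> y) i.
have em : ord_max = lift ord0 ord0 :> 'I_2 by apply: val_inj.
have e1 : s ord_max = y by rewrite em /s sconsS.
have := los (ball_fml L (k + l)%N ord0 ord_max) s.
rewrite sat_ball e1 /s scons0 => ->.
apply: filterS (filterI xk yl) => i /= [xi yi].
rewrite sat_ball -/(s ord_max) e1 scons0.
exact: ballD (ball_sym xi) yi.
Qed.

Definition diag x : ultrapower := cls (near_cst x).

Lemma diagE n (s : 'I_n -> M) : U [set i | (fun k => sval (diag (s k)) i) = s].
Proof.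
apply: filterS (filter_forall_ord (fun k => canonP (fun=> s k))) => i /= e.
exact: funext.
Qed.

Lemma diag_elementary : elementary diag.
Proof.
move=> n phi s; rewrite los; split=> h.
  by apply: filterS (diagE s) => i /= ->.
by have [i [/= + e]] := filter_ex (filterI h (diagE s)); rewrite e.
Qed.

Lemma type_of_diag (g : I -> M) : near_c g -> exists b : ultrapower,
  forall m (phi : fml L m.+1) (a : 'I_m -> M),
    type_of diag b phi a <-> U [set i | sat phi (scons (g i) a)].
Proof.
move=> gc; exists (cls gc) => m phi a; rewrite /type_of los.
have : U [set i | (fun k => sval (scons (cls gc) (diag \o a) k) i) = scons (g i) a].
  apply: filterS (filterI (canonP g) (diagE a)) => i /= [e1 e2].
  rewrite -(scons_eta (fun k => _)) scons0 /= e1; congr scons.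
  by rewrite -[RHS]e2; apply: funext => k; rewrite sconsS.
by move=> h; split=> h'; apply: filterS (filterI h h') => i /= [->].
Qed.

End Ultrapower.

(** The index set is M itself: the class of the identity realizes the formulas true on a set of the
    ultrafilter. The ball keeps this class at finite distance from the diagonal. *)
Lemma type_of_ultrafilter L (M : structure L) (U : set_system M) (c : M) (K : nat) :
  (forall f : fsym L, 0 < farity f ->
    exists k, forall s : 'I_(farity f) -> M, exists i, ball k (s i) (fint s)) ->
  local_structure M -> UltraFilter U -> U (ball K c) ->
  exists q : type_space M, forall m (phi : fml L m.+1) (a : 'I_m -> M),
    sval q m phi a <-> U [set b | sat phi (scons b a)].
Proof.
move=> Mb Ml UU UK.
have [b bP] := @type_of_diag L M Mb Ml M U c UU id (ex_intro _ K UK).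
have qP : exists (N : structure L) (f : M -> N) (b' : N), [/\ local_structure N, elementary f &
    type_of (@diag _ _ Mb Ml _ U c UU) b = type_of f b'].
  exists (@ultrapower _ _ Mb Ml _ U c UU), (@diag _ _ Mb Ml _ U c UU), b.
  by split; [exact: ultrapower_local|exact: diag_elementary|].
by exists (exist _ (type_of (@diag _ _ Mb Ml _ U c UU) b) qP : complete_type M).
Qed.

(** * Models of a complete local theory and their types *)

(** Variable [ord_max] is the centre of the 2-ball, the other [n] variables are the centres of the
    covering 1-balls. *)
Definition cover_fml L n : fml L n.+1 := FNot (bex 2 ord_max (FNot (FOrs (fun i : 'I_n =>
  FM1 (Var (lift ord0 (lift ord_max i))) (Var ord0))))).

Lemma sat_cover L n (N : structure L) (u : 'I_n.+1 -> N) : sat (cover_fml L n) u <->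
  forall y, ball 2 (u ord_max) y -> exists i, m1 (u (lift ord_max i)) y.
Proof.
rewrite /cover_fml sat_not sat_bex; split=> [h y uy|h [y [uy]]].
  apply: contrapT => nh; apply: h; exists y; split=> //.
  rewrite sat_not sat_ors => -[i] /=; rewrite scons0 sconsS => ?.
  by apply: nh; exists i.
rewrite sat_not sat_ors; apply; have [i] := h y uy.
by exists i; rewrite /= scons0 sconsS.
Qed.

(** Types and facts are studied over structures with these three properties, which every local model
    of T turns out to have. *)
Record tame L (M : structure L) : Prop := Tame {
  tame_local : local_structure M;
  tame_fun : forall f : fsym L, 0 < farity f ->
    exists k, forall s : 'I_(farity f) -> M, exists i, ball k (s i) (fint s);
  tame_cover : forall x : M, exists n (c : 'I_n -> M),
    forall y, ball 2 x y -> exists i, m1 (c i) y }.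

Section Models.
Variables (L : language) (T : theory L).
Hypotheses (T_complete : complete T) (T_bounded : bounded_functions T).

Lemma common_radius (M : structure L) n (z : M) (s : 'I_n -> M) :
  local_structure M -> exists R, forall i, ball R z (s i).
Proof.
move=> Ml; have /choice[R RP] := fun i => Ml z (s i).
by exists (\max_i R i) => i; apply: ballW (RP i); exact: leq_bigmax.
Qed.

(** Completeness decides only sentences with one unbounded quantifier, so the tuple is enclosed in a
    ball around some z. The radius is read off in M and kept in the sentence passed to N. *)
Lemma transfer (M N : structure L) n (phi : fml L n) :
  local_model T M -> local_model T N ->
  (exists s : 'I_n -> M, sat phi s) -> exists s : 'I_n -> N, sat phi s.
Proof.
move=> TM TN [s sphi]; have [z] := dom_inh M.
have [R RP] := common_radius z s (proj1 TM).
have [/(_ N TN)[z'] /sat_bexs [u [_ _]]|/(_ M TM)[]] :=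
    T_complete (SEx (bexs R (fren phi (lift ord_max)))).
  by rewrite sat_ren; exists (u \o lift ord_max).
pose u i := if unlift ord_max i is Some j then s j else z.
exists z; apply/sat_bexs; exists u; split.
- by rewrite /u unlift_none.
- by move=> i; rewrite /u; case: unlift => [j|]; [exact: RP|exact: ballxx].
by rewrite sat_ren (_ : _ \o _ = s) //; apply: funext => i /=; rewrite /u liftK.
Qed.

Lemma ball_cover (M : structure L) k (x : M) : finite_covers M ->
  exists s : seq {classic M}, forall y, ball k x y ->
    exists2 c : {classic M}, c \in s & ball 1 (c : M) y.
Proof.
move=> Mc; elim: k => [|k [s sP]].
  by exists [:: x] => y ->; exists x; [exact: mem_head|exact: ballxx].
have /choice[g gP] c : exists t : seq {classic M}, forall y : M, ball 2 (c : M) y ->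
    exists2 c' : {classic M}, c' \in t & ball 1 (c' : M) y.
  have [C /(@finite_seqP {classic M})[t ->] Ct] := Mc c.
  by exists t => y /Ct[c' ? ?]; exists c'.
exists (flatten [seq g c | c <- s]) => y /ball_sym[w [yw /ball_sym/sP[c cs cw]]].
have [|c' c'g c'y] := gP c y.
  rewrite -[2]/(1 + 1)%N; apply: ballD cw _.
  by apply/ball1E; exact: m1_sym.
by exists c' => //; apply/(@flatten_mapP {classic M} {classic M} g); exists c.
Qed.

(** An automorphism brings any point within k of the fixed [a], and its 2-ball into the (k + 2)-ball
    of [a]; one finite cover of the latter serves everywhere. *)
Lemma uniform_cover (M : structure L) :
  local_structure M -> orbit_bounded M -> finite_covers M ->
  exists n R, forall x : M, exists c : 'I_n -> M,
    (forall i, ball R x (c i)) /\ forall y, ball 2 x y -> exists i, m1 (c i) y.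
Proof.
move=> Ml [k Mk] Mc; have [a] := dom_inh M.
have [s sP] := ball_cover (k + 2) a Mc.
pose c (i : 'I_(size s)) : M := tnth (in_tuple s) i.
have [R RP] := common_radius a c Ml.
exists (size s), (k + R)%N => x; have [alpha aP xa] := Mk x a.
have ae := automorphism_elementary aP.
exists (alpha \o c); split=> [i|y xy].
  by apply: ballD xa _; apply/(elementary_ball _ _ _ ae).
have [[beta _ bK] _ _ _] := aP.
have [|d ds dy] := sP (beta y).
  apply/(elementary_ball _ _ _ ae); rewrite bK.
  by apply: ballD xy; exact: ball_sym.
have /tnthP[i di] : d \in in_tuple s by [].
exists i; apply/ball1E; rewrite -(bK y).
by apply/(elementary_ball _ _ _ ae); rewrite /c -di.
Qed.

Lemma local_model_tame (M0 M : structure L) :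
  local_model T M0 -> orbit_bounded M0 -> finite_covers M0 ->
  local_model T M -> tame M.
Proof.
move=> TM0 oM0 cM0 TM; split; first by case: TM.
  by move=> f /T_bounded[k kP]; exists k; exact: kP.
have [n [R nR]] := uniform_cover (proj1 TM0) oM0 cM0.
have [/(_ M TM) h x|/(_ M0 TM0)[]] := T_complete (SAll (bexs R (cover_fml L n))).
  have /sat_bexs[u [<- _ /sat_cover h']] := h x.
  by exists n, (u \o lift ord_max).
move=> x; have [c [cR cP]] := nR x.
apply/sat_bexs; exists (fun i => if unlift ord_max i is Some j then c j else x).
split=> [|i|]; first by rewrite unlift_none.
  by case: unlift => [j|]; [exact: cR|exact: ballxx].
by apply/sat_cover => y; rewrite unlift_none => /cP[i]; exists i; rewrite liftK.
Qed.

End Models.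

Notation m1_fml := (FM1 (Var ord0) (Var (lift ord0 ord0))).

Section Types.
Variables (L : language) (M : structure L).
Hypothesis M_tame : tame M.

Lemma realize (q : type_space M) : exists (N : structure L) (f : M -> N) (b : N),
  [/\ local_structure N, elementary f & forall m (phi : fml L m.+1) (a : 'I_m -> M),
      sval q m phi a <-> sat phi (scons b (f \o a))].
Proof.
have [N [f [b [Nl fe e]]]] := svalP q.
by exists N, f, b; split=> // m phi a; rewrite e.
Qed.

(** The cover, being a local formula, holds in N around images of points of M. Induction along a
    path from b: a point next to one near [f c] lies in the 2-ball of [f c], hence near some
    [f (d i)]. *)
Lemma elementary_near (N : structure L) (f : M -> N) (b : N) :
  local_structure N -> elementary f -> exists c, m1 b (f c).
Proof.
move=> Nl fe; have [x] := dom_inh M.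
have [k] := Nl b (f x); elim: k b => [b <- |k IH b [w [bw /IH[c wc]]]].
  by exists x; exact: m1_refl.
have [n [d dP]] := tame_cover M_tame c.
pose u i := if unlift ord_max i is Some j then d j else c.
have /sat_cover : sat (cover_fml L n) (f \o u).
  by apply/fe/sat_cover => y; rewrite /u unlift_none => /dP[i]; exists i; rewrite liftK.
rewrite /u /= unlift_none => /(_ b)[|i].
  by exists w; split; [exact: m1_sym|apply/ball1E; exact: m1_sym].
by rewrite liftK => ?; exists (d i); exact: m1_sym.
Qed.

(** By directedness the parts of the ball cut out by the formulas form a filter base, and an
    ultrafilter containing it is a type. *)
Lemma type_compact (I : Type) (m : I -> nat) (phi : forall i, fml L (m i).+1)
    (a : forall i, 'I_(m i) -> M) (c : M) K :
  (forall i j, exists k, forall b, sat (phi k) (scons b (a k)) ->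
     sat (phi i) (scons b (a i)) /\ sat (phi j) (scons b (a j))) ->
  (forall i, exists b, ball K c b /\ sat (phi i) (scons b (a i))) ->
  exists q : type_space M, forall i, sval q _ (phi i) (a i).
Proof.
move=> dir cons.
(* [None] contributes the ball alone, so the base is nonempty even when [I] is empty. *)
pose D (o : option I) : set M :=
  if o is Some i then [set b | ball K c b /\ sat (phi i) (scons b (a i))]
  else ball K c.
have FD : ProperFilter (filter_from setT D).
  apply: filter_from_proper; last first.
    by case=> [i|] _; [exact: cons|exists c; exact: ballxx].
  apply: filter_fromT_filter; first by exists None.
  move=> [i|] [j|].
  - have [k kP] := dir i j; exists (Some k) => b [cb /kP[? ?]].
    by split.
  - by exists (Some i) => b [].
  - by exists (Some j) => b [].
  - by exists None.
have [U [UU DU]] := ultraFilterLemma FD.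
have Uc : U (ball K c) by apply: DU; exists None.
have [q qP] := type_of_ultrafilter (tame_fun M_tame) (tame_local M_tame) UU Uc.
by exists q => i; apply/qP/DU; exists (Some i) => // b [].
Qed.

Definition tp (c : M) : type_space M.
Proof.
exists (type_of id c); exists M, id, c; split=> //.
exact: tame_local.
Defined.

Lemma mu1P (p q : type_space M) : mu1 p q <->
  forall a b : M, sval p _ m1_fml (fun _ : 'I_1 => a) ->
    sval q _ m1_fml (fun _ : 'I_1 => b) -> ball 5 a b.
Proof.
have [N [f [u [_ _ pE]]]] := realize p; have [N' [f' [v [_ _ qE]]]] := realize q.
have em : ord_max = lift ord0 ord0 :> 'I_2 by apply: val_inj.
have h (s : 'I_2 -> M) : sat (FNot (ball_fml L 5 ord0 ord_max)) s <->
    ~ ball 5 (s ord0) (s ord_max).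
  by rewrite sat_not sat_ball.
split=> [pq a b|H s].
  rewrite pE qE /= !scons0 !sconsS /= => ua vb; apply: contrapT => nab.
  have [|i] := pq (scons a (fun=> b)); first by apply/h; rewrite em scons0 sconsS.
  rewrite /=; case: (unliftP ord0 i) => [j|] ->; rewrite ?scons0 ?sconsS ?pE ?qE /=.
    by rewrite !scons0 !sconsS /= sconsS.
  by rewrite !scons0 !sconsS /= scons0.
move=> /h nab; apply: contrapT => /forallNP nH; apply: nab; rewrite em; apply: H.
  have := nH ord0; rewrite /= scons0 !pE sat_not /= !scons0 !sconsS /=.
  by move/contrapT.
have := nH ord_max; rewrite /= em sconsS !qE sat_not /= !scons0 !sconsS /=.
by move/contrapT.
Qed.

Lemma mu1_realP (p q : type_space M) (N : structure L) (f : M -> N) (u : N)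
    (N' : structure L) (f' : M -> N') (v : N') :
  (forall m (phi : fml L m.+1) (a : 'I_m -> M),
      sval p m phi a <-> sat phi (scons u (f \o a))) ->
  (forall m (phi : fml L m.+1) (a : 'I_m -> M),
      sval q m phi a <-> sat phi (scons v (f' \o a))) ->
  mu1 p q <-> forall a b, m1 u (f a) -> m1 v (f' b) -> ball 5 a b.
Proof.
move=> pE qE; rewrite mu1P.
have e1 a : sval p _ m1_fml (fun _ : 'I_1 => a) <->
    m1 u (f a) by rewrite pE /= scons0 sconsS.
have e2 a : sval q _ m1_fml (fun _ : 'I_1 => a) <->
    m1 v (f' a) by rewrite qE /= scons0 sconsS.
by split=> H a b; [move=> /e1 + /e2|move=> /e1 + /e2]; exact: H.
Qed.

End Types.

(** * Facts of the pattern language and elimination of a point *)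

(* A fact about points of X: the relation Def_t for the pattern t, applied to a
   tuple of points.  Its truth depends on a map from X to a pattern structure. *)
Record fact (L : language) (X : Type) :=
  Fact { fpat : pattern L; fpt : 'I_(parity fpat) -> X }.
Arguments Fact {L X}.
Arguments fpt {L X}.

Definition ftrue L (J : pstruct L) X (h : X -> J) (f : fact L X) := Def (h \o fpt f).

Definition fact_map L X Y (g : X -> Y) (f : fact L X) : fact L Y :=
  Fact (fpat f) (g \o fpt f).

Definition fsupp L X (f : fact L X) : set X := [set fpt f i | i in setT].

Lemma eq_ftrue L (J : pstruct L) X (h h' : X -> J) (f : fact L X) :
  (forall x, fsupp f x -> h x = h' x) -> ftrue h f -> ftrue h' f.
Proof.
move=> e; rewrite /ftrue (_ : h \o fpt f = h' \o fpt f) //.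
by apply: funext => i; apply: e; exists i.
Qed.

Section Elimination.
Variables (L : language) (X : Type).
Implicit Types (x : X) (f : fact L X).

(** A fact splits at x into what x must satisfy and what the other points may satisfy instead. In
    [frest] the positions of x carry False, which leaves the arity unchanged. *)
Definition fselect x f : fml L (pparams (fpat f)).+1 :=
  FOrs (fun i => if `[< fpt f i = x >] then pphi i else FFalse).

Definition frest x f (i : 'I_(parity (fpat f))) : fml L (pparams (fpat f)).+1 :=
  if `[< fpt f i = x >] then FFalse else pphi i.

(** Implied by the two facts together, it makes their demands on x directed: at parameters where all
    other points fail their formulas, x must satisfy both selected formulas. *)
Definition fcomb x f1 f2 : fact L X :=
  let m1 := pparams (fpat f1) in let m2 := pparams (fpat f2) in
  let l := @lshift m1 m2 in let r := @rshift m1 m2 in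
  Fact
    (@Pattern L (parity (fpat f1) + parity (fpat f2)).+1 (m1 + m2)
      (scons (FAnd (fren (fselect x f1) (shift l)) (fren (fselect x f2) (shift r)))
        (fun i => match fintype.split i with
           | inl i1 => fren (frest x i1) (shift l)
           | inr i2 => fren (frest x i2) (shift r)
           end))
      (FAnd (fren (palpha (fpat f1)) l) (fren (palpha (fpat f2)) r)))
    (scons x (fun i => match fintype.split i with
       | inl i1 => fpt f1 i1
       | inr i2 => fpt f2 i2
       end)).

(* The radius 6 is 5 + 1: if mu_1(p, q), m_1(x, a) is in p and m_1(x, c) is in
   q then m_5(a, c), so p contains m_6(x, c). *)
Definition felim x x0 f : fact L X :=
  let m := pparams (fpat f) in
  let s := @lift m.+1 ord0 in
  Fact
    (@Pattern L (parity (fpat f)).+1 m.+1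
      (scons (FNot m1_fml)
        (fun i => fren (frest x i) (shift s)))
      (FAnd (fren (palpha (fpat f)) s)
        (FNot (bex 6 ord0 (fren (fselect x f) (shift s))))))
    (scons x0 (fun i => if `[< fpt f i = x >] then x0 else fpt f i)).

Lemma fsupp_comb x f1 f2 y :
  fsupp (fcomb x f1 f2) y -> [\/ y = x, fsupp f1 y | fsupp f2 y].
Proof.
move=> [i _ <-]; rewrite /fcomb /=.
case: (unliftP ord0 i) => [j|] ->; rewrite ?scons0 ?sconsS; last by constructor 1.
by case: fintype.split => k; [constructor 2|constructor 3]; exists k.
Qed.

Lemma fsupp_elim x x0 f y :
  fsupp (felim x x0 f) y -> y = x0 \/ (y <> x /\ fsupp f y).
Proof.
move=> [i _ <-]; rewrite /felim /=.
case: (unliftP ord0 i) => [j|] ->; rewrite ?scons0 ?sconsS; last by left.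
by case: asboolP => h; [left|right; split=> //; exists j].
Qed.

End Elimination.

(** * Truth of facts in type spaces *)

Section TypeFacts.
Variables (L : language) (M : structure L).
Hypothesis M_tame : tame M.
Implicit Types (p q : type_space M).

Lemma type_not q m (phi : fml L m.+1) (a : 'I_m -> M) :
  sval q m (FNot phi) a <-> ~ sval q m phi a.
Proof. by have [N [f [b [_ _ qE]]]] := realize q; rewrite !qE. Qed.

Lemma type_and q m (phi psi : fml L m.+1) (a : 'I_m -> M) :
  sval q m (FAnd phi psi) a <-> sval q m phi a /\ sval q m psi a.
Proof. by have [N [f [b [_ _ qE]]]] := realize q; rewrite !qE sat_and. Qed.

Lemma type_ors q m k (phi : 'I_k -> fml L m.+1) (a : 'I_m -> M) :
  sval q m (FOrs phi) a <-> exists i, sval q m (phi i) a.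
Proof.
have [N [f [b [_ _ qE]]]] := realize q; rewrite !qE sat_ors.
by split=> -[i]; exists i; apply/qE.
Qed.

Lemma type_ren q m n (r : 'I_m -> 'I_n) (phi : fml L m.+1) (a : 'I_n -> M) :
  sval q n (fren phi (shift r)) a <-> sval q m phi (a \o r).
Proof.
by have [N [f [b [_ _ qE]]]] := realize q; rewrite !qE sat_ren scons_shift.
Qed.

Lemma type_false q m (a : 'I_m -> M) : ~ sval q m FFalse a.
Proof. by have [N [f [b [_ _ qE]]]] := realize q; rewrite !qE. Qed.

Lemma ftrue_split X (x : X) (h : X -> type_space M) (f : fact L X) :
  ftrue h f <-> forall a, sat (palpha (fpat f)) a ->
    sval (h x) _ (fselect x f) a \/ exists i, sval (h (fpt f i)) _ (frest x i) a.
Proof.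
rewrite /fselect /frest; split=> H a /H.
  move=> [i hi]; have [e|e] := pselect (fpt f i = x); [left|right].
    apply/type_ors; exists i; case: asboolP => // _; by rewrite -e.
  by exists i; case: asboolP.
move=> [/type_ors[i]|[i]]; case: asboolP => e hi; exists i => //.
- by rewrite /= e.
- by case: (type_false hi).
- by case: (type_false hi).
Qed.

Lemma ftrue_comb X (x : X) (h : X -> type_space M) f1 f2 :
  ftrue h f1 -> ftrue h f2 -> ftrue h (fcomb x f1 f2).
Proof.
move=> /(ftrue_split x) h1 /(ftrue_split x) h2 a /sat_and[/sat_ren a1 /sat_ren a2].
have [s1|[i s1]] := h1 _ a1; last first.
  exists (lift ord0 (lshift _ i)); rewrite /= !sconsS.
  by rewrite (unsplitK (inl i)) type_ren.
have [s2|[i s2]] := h2 _ a2; last first.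
  exists (lift ord0 (rshift _ i)); rewrite /= !sconsS.
  by rewrite (unsplitK (inr i)) type_ren.
by exists ord0; rewrite /= !scons0 type_and !type_ren.
Qed.

Lemma ftrue_elim X (x x0 : X) (h : X -> type_space M) f :
  mu1 (h x) (h x0) -> ftrue h f -> ftrue h (felim x x0 f).
Proof.
move=> hm /(ftrue_split x) hf a /sat_and[/sat_ren a1 /sat_not a2].
have [s1|[i s1]] := hf _ a1; last first.
  exists (lift ord0 i); rewrite /= !sconsS type_ren.
  by move: s1; rewrite /frest; case: asboolP => // _ /type_false.
exists ord0; rewrite /= !scons0 type_not => s0; apply: a2.
have [N [g [b [Nl ge qE]]]] := realize (h x).
have [d bd] := elementary_near M_tame b Nl ge.
apply/ge/sat_bex; exists b; split.
  rewrite -[6]/(5 + 1)%N; apply: ballD (_ : ball 5 _ (g d)) _; last first.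
    by apply/ball1E; exact: m1_sym.
  apply/(elementary_ball _ _ _ ge)/ball_sym; move/mu1P: hm; apply.
    by rewrite qE /= scons0 sconsS.
  have e : a = scons (a ord0) (a \o lift ord0) by rewrite -[LHS]scons_eta.
  have [N' [g' [b' [_ _ qE']]]] := realize (h x0).
  by move: s0; rewrite !qE' /= !scons0 !sconsS.
by rewrite sat_ren scons_shift; apply/qE.
Qed.

(** At parameters where no other point satisfies its formula, the value of x must contain the
    selected formula. These demands are directed by the first hypothesis and satisfiable in one ball
    by the second, so some type meets them all. *)
Lemma fact_extend X (x : X) (Th : set (fact L X)) (f : X -> type_space M) c K :
  (forall f1 f2, Th f1 -> Th f2 -> Th (fcomb x f1 f2)) ->
  (forall phi, Th phi -> forall a, sat (palpha (fpat phi)) a ->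
     (forall i, ~ sval (f (fpt phi i)) _ (frest x i) a) ->
     exists b, ball K c b /\ sat (fselect x phi) (scons b a)) ->
  exists q, forall g : X -> type_space M,
    g x = q -> (forall y, y <> x -> g y = f y) -> forall phi, Th phi -> ftrue g phi.
Proof.
move=> Tcomb Tcons.
pose P (s : {phi : fact L X & 'I_(pparams (fpat phi)) -> M}) :=
  [/\ Th (projT1 s), sat (palpha (fpat (projT1 s))) (projT2 s) &
   forall i, ~ sval (f (fpt (projT1 s) i)) _ (frest x i) (projT2 s)].
have [|[[phi a] [/= ? ? ?]]|q qP] := @type_compact _ _ M_tame {s | P s}
    (fun s => pparams (fpat (projT1 (sval s))))
    (fun s => fselect x (projT1 (sval s))) (fun s => projT2 (sval s)) c K.
- move=> [[f1 a1] [/= T1 s1 r1]] [[f2 a2] [/= T2 s2 r2]].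
  pose a i := match fintype.split i with inl i1 => a1 i1 | inr i2 => a2 i2 end.
  have e1 : a \o @lshift _ _ = a1.
    by apply: funext => i; rewrite /a /= (unsplitK (inl i)).
  have e2 : a \o @rshift _ _ = a2.
    by apply: funext => i; rewrite /a /= (unsplitK (inr i)).
  have Ps : P (existT _ (fcomb x f1 f2) a).
    split=> /=; [exact: Tcomb|by apply/sat_and; rewrite !sat_ren e1 e2|].
    move=> i; rewrite /frest; case: asboolP => [_ /type_false//|] /=.
    case: (unliftP ord0 i) => [j|] ->; rewrite ?scons0 ?sconsS //.
    by case: fintype.split => k _; rewrite type_ren ?e1 ?e2; [exact: r1|exact: r2].
  exists (exist _ _ Ps) => b /= /sat_ors[i]; case: asboolP => //=.
  case: (unliftP ord0 i) => [j|] ->; rewrite ?scons0 ?sconsS.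
    case: fintype.split => k e; rewrite sat_ren /frest; case: asboolP => //.
  by move=> _ /sat_and; rewrite !sat_ren !scons_shift e1 e2.
- exact: Tcons.
exists q => g gx gy phi Tphi; apply/(ftrue_split x) => a sa.
have [r|/forallNP r] := pselect (exists i, sval (g (fpt phi i)) _ (frest x i) a).
  by right.
left; have Ps : P (existT _ phi a).
  split=> //= i; have := r i; rewrite /frest; case: asboolP => [_ _ /type_false//|ne].
  by rewrite gy.
by rewrite gx; exact: (qP (exist _ _ Ps)).
Qed.

Lemma type_near q : exists c : M, sval q _ m1_fml
  (fun _ : 'I_1 => c).
Proof.
have [N [f [b [Nl fe qE]]]] := realize q.
have [c bc] := elementary_near M_tame b Nl fe.
by exists c; rewrite qE /= scons0 sconsS.
Qed.

(** Some m_1(x, c) lies in [f x0]; taking this c as the extra parameter of [felim] disables its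
    first alternative. All witnesses still required then lie in the 6-ball of c. *)
Lemma fact_elim X (x x0 : X) (Th : set (fact L X)) (f : X -> type_space M) :
  (forall f1 f2, Th f1 -> Th f2 -> Th (fcomb x f1 f2)) ->
  (forall phi, Th phi -> ftrue f (felim x x0 phi)) ->
  exists q, forall g : X -> type_space M,
    g x = q -> (forall y, y <> x -> g y = f y) -> forall phi, Th phi -> ftrue g phi.
Proof.
move=> Tcomb Telim; have [c cP] := type_near (f x0).
apply: (fact_extend (c := c) (K := 6)) => // phi Tphi a sa r.
apply: contrapT => nb.
have e : scons c a \o lift ord0 = a by apply: funext => i /=; rewrite sconsS.
have [|i] := Telim phi Tphi (scons c a).
  apply/sat_and; split; first by rewrite sat_ren e.
  rewrite sat_not sat_bex => -[b []].
  by rewrite scons0 sat_ren scons_shift e => ? ?; apply: nb; exists b.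
rewrite /=; case: (unliftP ord0 i) => [j|] ->; rewrite ?scons0 ?sconsS.
  rewrite type_ren e; move: (r j); rewrite /frest.
  by case: asboolP => [_ _ /type_false|].
rewrite type_not; apply; move: cP.
have [N [g [b [_ _ qE]]]] := realize (f x0).
by rewrite !qE /= !scons0 !sconsS /= scons0.
Qed.

End TypeFacts.

(** * Extension of homomorphisms *)

Lemma chain_bound (U : Type) (R : rel U) (C : set U) n (s : 'I_n -> U) :
  (forall r t u, R r t -> R t u -> R r u) -> total_on C R -> C !=set0 ->
  (forall i, C (s i)) -> exists2 t, C t & forall i, R (s i) t.
Proof.
move=> Rtr Ctot [t0 Ct0]; elim: n s => [|n IH] s Cs; first by exists t0 => // -[].
have [t Ct tP] := IH (fun i => s (lift ord0 i)) (fun i => Cs _).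
have [r|r] := Ctot _ _ (Cs ord0) Ct.
  by exists t => // i; case: (unliftP ord0 i) => [j|] ->.
exists (s ord0) => // i; case: (unliftP ord0 i) => [j|] ->; first exact: Rtr (tP j) r.
by case: (Ctot _ _ (Cs ord0) (Cs ord0)).
Qed.

Section TypeSpaces.
Variable L : language.

Lemma type_eqP (M : structure L) (p q : type_space M) :
  (forall m (phi : fml L m.+1) (a : 'I_m -> M), sval p m phi a -> sval q m phi a) ->
  p = q.
Proof.
move=> pq; case: p q pq => [p hp] [q hq] pq.
have e : p = q.
  apply: functional_extensionality_dep => m; apply: funext => phi.
  apply: funext => a; apply: propext.
  split; first exact: pq.
  move=> h; apply: contrapT => /(type_not (exist _ p hp : type_space M)) /pq.
  by move/(type_not (exist _ q hq : type_space M)).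
by subst q; congr exist; exact: Prop_irrelevance.
Qed.

(** Inclusion of types, one formula at a time: phi(x) implies phi(y). As types are complete,
    inclusion is equality, so maps preserving facts respect equality. *)
Definition eqfact X (x y : X) m (phi : fml L m.+1) : fact L X :=
  Fact (@Pattern L 2 m (scons (FNot phi) (fun=> phi)) (FTrue L m))
    (scons x (fun=> y)).

Lemma ftrue_eqfact (M : structure L) X (h : X -> type_space M) x y m (phi : fml L m.+1) :
  ftrue h (eqfact x y phi) <-> forall a, sval (h x) m phi a -> sval (h y) m phi a.
Proof.
split=> [H a hx|H a _].
  have [|i] := H a; first by move=> [].
  rewrite /=; case: (unliftP ord0 i) => [j|] ->; rewrite ?scons0 ?sconsS //.
  by rewrite type_not.
have [/H hy|hx] := pselect (sval (h x) m phi a).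
  by exists ord_max; rewrite /= (_ : ord_max = lift ord0 ord0) ?sconsS //; apply: val_inj.
by exists ord0; rewrite /= !scons0 type_not.
Qed.

Lemma fsupp_eqfact X (x y : X) m (phi : fml L m.+1) z :
  fsupp (eqfact x y phi) z -> z = x \/ z = y.
Proof.
by move=> [i _ <-] /=; case: (unliftP ord0 i) => [j|] ->;
  rewrite ?scons0 ?sconsS; [right|left].
Qed.

Lemma facts_inj (M M' : structure L) X (h : X -> type_space M) (h' : X -> type_space M')
    (A : set X) x y :
  (forall f, fsupp f `<=` A -> ftrue h f -> ftrue h' f) -> A x -> A y ->
  h x = h y -> h' x = h' y.
Proof.
move=> H Ax Ay e; apply: type_eqP => m phi; apply/(ftrue_eqfact h'); apply: H.
  by move=> z fz; case: (fsupp_eqfact fz) => ->.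
by apply/ftrue_eqfact; rewrite e.
Qed.

Definition mufact X (x y : X) : fact L X := Fact (mu1_pattern L) (scons x (fun=> y)).

Lemma ftrue_mufact (J : pstruct L) X (h : X -> J) x y :
  ftrue h (mufact x y) <-> mu1 (h x) (h y).
Proof. by rewrite /ftrue /mu1 /mufact /= comp_scons. Qed.

Lemma mu1_phom (J K : pstruct L) (h : J -> K) x y : phom h -> mu1 x y -> mu1 (h x) (h y).
Proof. by move=> hh xy; rewrite -ftrue_mufact; apply: hh. Qed.

Lemma phom_ftrue (J K : pstruct L) X (h : J -> K) (g : X -> J) (f : fact L X) :
  phom h -> ftrue g f -> ftrue (h \o g) f.
Proof. by move=> hh; exact: hh. Qed.

Lemma phom_comp (J K K' : pstruct L) (h : K -> K') (g : J -> K) :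
  phom h -> phom g -> phom (h \o g).
Proof. by move=> hh gh t p /gh/hh. Qed.

Lemma mu1_tp (M : structure L) (M_tame : tame M) (p : type_space M) (c : M) :
  sval p _ m1_fml (fun _ : 'I_1 => c) ->
  mu1 p (tp M_tame c) /\ mu1 (tp M_tame c) p.
Proof.
have [N [f [b [_ fe pE]]]] := realize p.
have qE m (phi : fml L m.+1) (a : 'I_m -> M) : sval (tp M_tame c) m phi a <->
  sat phi (scons c (id \o a)) by [].
rewrite pE /= scons0 sconsS /= => bc.
have H a d : m1 b (f a) -> m1 c d -> ball 3 a d.
  move=> ba cd; rewrite -[3]/(2 + 1)%N; apply: ballD (_ : ball 2 _ c) _; last exact/ball1E.
  apply/(elementary_ball _ _ _ fe); exists b; split; first exact: m1_sym.
  exact/ball1E.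
split; [apply/(mu1_realP pE qE) => a d ba cd|apply/(mu1_realP qE pE) => d a cd ba].
  by apply: ballW (H _ _ ba cd).
by apply: ballW (ball_sym (H _ _ ba cd)).
Qed.

(** Every type is mu_1-close to a type realized in M, and consecutive points of an m_1-path in M
    have mu_1-close types. *)
Lemma type_connected (M : structure L) (M_tame : tame M) (B : set (type_space M)) :
  B !=set0 -> (forall p q, B q -> mu1 p q -> B p) -> forall p, B p.
Proof.
move=> [q0 Bq0] Bmu p.
have tpM (c : M) : sval (tp M_tame c) _ m1_fml
    (fun _ : 'I_1 => c) by rewrite /= /type_of /= scons0 sconsS; exact: m1_refl.
have [c0 c0P] := type_near M_tame q0; have [c cP] := type_near M_tame p.
have Bc0 : B (tp M_tame c0) by apply: Bmu Bq0 _; case: (mu1_tp M_tame c0P).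
suff Bc : B (tp M_tame c) by apply: Bmu Bc _; case: (mu1_tp M_tame cP).
have [k] := tame_local M_tame c0 c.
elim: k c0 {c0P} Bc0 => [c0 Bc0 ->//|k IH c0 Bc0 [w [c0w wc]]].
apply: IH wc; apply: Bmu Bc0 _.
suff : sval (tp M_tame w) _ m1_fml
    (fun _ : 'I_1 => c0) by case/(mu1_tp M_tame).
by rewrite /= /type_of /= scons0 sconsS; exact: m1_sym.
Qed.

Section Extension.
Variables (M M' : structure L).
Hypotheses (M_tame : tame M) (M'_tame : tame M').
Variables (I X : Type) (F : set_system I) (h : I -> X -> type_space M).
Context {FF : Filter F}.

Let Th : set (fact L X) := [set f | F [set i | ftrue (h i) f]].

Let Th_comb x f1 f2 : Th f1 -> Th f2 -> Th (fcomb x f1 f2).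
Proof. by move=> h1 h2; apply: filterS (filterI h1 h2) => i [] /=; exact: ftrue_comb. Qed.

(* Facts holding F-almost everywhere are transported one point at a time, the
   possible values of the new point being governed by [fact_elim]. *)
Lemma hom_extend (A : set X) (f0 : X -> type_space M') :
  (forall phi, F [set i | ftrue (h i) phi] -> fsupp phi `<=` A -> ftrue f0 phi) ->
  (forall B : set X, A `<=` B ->
     (forall x x0, B x0 -> F [set i | mu1 (h i x) (h i x0)] -> B x) -> forall x, B x) ->
  exists f : X -> type_space M', (forall x, A x -> f x = f0 x) /\
    forall phi, F [set i | ftrue (h i) phi] -> ftrue f phi.
Proof.
move=> f0P conn.
pose P (s : set X * (X -> type_space M')) := [/\ A `<=` s.1,
  forall x, A x -> s.2 x = f0 x & forall phi, Th phi -> fsupp phi `<=` s.1 -> ftrue s.2 phi].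
pose R (s t : {s | P s}) := `[< (sval s).1 `<=` (sval t).1 /\
  forall x, (sval s).1 x -> (sval t).2 x = (sval s).2 x >].
have Ps0 : P (A, f0) by split.
have Rtr r s t : R r s -> R s t -> R r t.
  move=> /asboolP[rs rse] /asboolP[st ste]; apply/asboolP; split.
    exact: subset_trans st.
  by move=> x rx; rewrite ste ?rse //; exact: rs.
have Rxx s : R s s by apply/asboolP; split.
have [C Ctot|[[B f] Ps] smax] := @ZL_preorder _ (exist _ _ Ps0) R Rxx Rtr.
- have [->|/set0P Cn0] := eqVneq C set0; first by exists (exist _ _ Ps0).
  pose B := [set x | exists2 s, C s & (sval s).1 x].
  have /choice[f fP] x : exists y, forall s, C s -> (sval s).1 x -> (sval s).2 x = y.
    have [[s Cs sx]|nx] := pselect (B x); last first.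
      by exists (f0 x) => s Cs sx; case: nx; exists s.
    exists ((sval s).2 x) => t Ct tx.
    by have [/asboolP[_ ->]|/asboolP[_ ->]] := Ctot _ _ Cs Ct.
  have Bfin (phi : fact L X) : fsupp phi `<=` B ->
      exists2 s, C s & fsupp phi `<=` (sval s).1.
    move=> sB; have /choice[u uP] i : exists s, C s /\ (sval s).1 (fpt phi i).
      by have [|s ? ?] := sB (fpt phi i); [exists i|exists s].
    have [s Cs sP] := chain_bound Rtr Ctot Cn0 (fun i => proj1 (uP i)).
    exists s => // _ [i _ <-]; have /asboolP[us _] := sP i.
    by apply: us; case: (uP i).
  have PB : P (B, f).
    split=> /=.
    - by have [s Cs] := Cn0 => x Ax; exists s => //; case: (svalP s) => + _ _; exact.
    - have [s Cs] := Cn0 => x Ax; have [As sf0 _] := svalP s.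
      by rewrite -(fP _ _ Cs) ?sf0 //; exact: As.
    - move=> phi Tphi /Bfin[s Cs ss]; have [_ _ sT] := svalP s.
      apply: (eq_ftrue (h := (sval s).2)); last exact: sT.
      by move=> x /ss sx; exact: fP.
  exists (exist _ _ PB) => s Cs; apply/asboolP; split=> x sx /=; first by exists s.
  by rewrite (fP _ _ Cs).
have [/= AB fA fT] := Ps; exists f; split=> // phi Tphi; apply: (fT) => //.
suff Ball x : B x by move=> x _; exact: Ball.
move: x; apply: conn => // x x0 Bx0 Fmu; apply: contrapT => nBx.
(* Eliminating x from such a fact leaves only points of [B], where [f] already respects what holds
   almost everywhere. *)
pose Thx := [set phi | Th phi /\ fsupp phi `<=` B `|` [set x]].
have [||q qP] := @fact_elim _ _ M'_tame X x x0 Thx f.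
- move=> f1 f2 [T1 s1] [T2 s2]; split; first exact: Th_comb.
  by move=> y fy; case: (fsupp_comb fy) => [->|/s1|/s2] //; right.
- move=> psi [Tpsi spsi]; apply: fT.
    apply: filterS (filterI Tpsi Fmu) => i [h1 h2].
    exact: ftrue_elim.
  by move=> y fy; case: (fsupp_elim fy) => [->//|[yx /spsi[]//]].
pose g y := if `[< y = x >] then q else f y.
have gx : g x = q by rewrite /g; case: asboolP.
have gy y : y <> x -> g y = f y by rewrite /g; case: asboolP.
have gB y : B y -> g y = f y by move=> By; apply: gy => yx; rewrite -yx in nBx.
have Pg : P (B `|` [set x], g).
  split=> /= [y Ay|y Ay|psi Tpsi sy]; first by left; exact: AB.
    by rewrite gB ?fA //; exact: AB.
  exact: qP.
have Rg : R (exist _ _ Ps) (exist _ _ Pg).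
  by apply/asboolP; split=> y By /=; [left|exact: gB].
by have /asboolP[/= H _] := smax _ Rg; apply: nBx; apply: H; right.
Qed.

End Extension.
End TypeSpaces.

(** * Existence of the core *)

Section Core.
Variables (L : language) (T : theory L).
Hypotheses (T_complete : complete T) (T_tame : forall M, local_model T M -> tame M).

(** If some parameters in [M'] had no witness in the (k + 1)-ball of [c], the same configuration
    would occur in [M] around some point. An automorphism moves that point within k of a point [e]
    next to the type [h i x], whose realization is a witness at distance at most k + 1: a
    contradiction. *)
Lemma base_point (M M' : structure L) I X (F : set_system I) (FF : ProperFilter F)
    (h : I -> X -> type_space M) (x : X) :
  local_model T M -> orbit_bounded M -> local_model T M' ->
  exists q : type_space M', forall phi, F [set i | ftrue (h i) phi] ->
    fsupp phi `<=` [set x] -> ftrue (fun=> q) phi.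
Proof.
move=> TM [k kP] TM'; have M_tame := T_tame TM; have M'_tame := T_tame TM'.
have [c] := dom_inh M'.
pose Th := [set phi | F [set i | ftrue (h i) phi] /\ fsupp phi `<=` [set x]].
pose p0 := tp M'_tame c.
have [||q qP] := @fact_extend _ _ M'_tame X x Th (fun=> p0) c (k + 1)%N.
- move=> f1 f2 [F1 s1] [F2 s2]; split.
    apply: filterS (filterI F1 F2) => i [h1 h2].
    by apply: ftrue_comb.
  by move=> y fy; case: (fsupp_comb fy) => [|/s1|/s2].
- move=> phi [Fphi sphi] a sa _; apply: contrapT => nb.
  pose psi := FAnd (fren (palpha (fpat phi)) (lift ord0))
    (FNot (bex (k + 1) ord0 (fren (fselect x phi) (shift (lift ord0))))).
  have psiP (N : structure L) (s : 'I_(pparams (fpat phi)).+1 -> N) : sat psi s <->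
      sat (palpha (fpat phi)) (s \o lift ord0) /\
      ~ exists b, ball (k + 1) (s ord0) b /\
        sat (fselect x phi) (scons b (s \o lift ord0)).
    rewrite /psi sat_and sat_ren sat_not sat_bex.
    split=> -[h1 h2]; split=> // -[b [cb sb]]; apply: h2; exists b; split=> //.
      by rewrite sat_ren scons_shift.
    by move: sb; rewrite sat_ren scons_shift.
  have [|s spsi] := transfer T_complete TM' TM (phi := psi).
    exists (scons c a); apply/psiP.
    have -> : scons c a \o lift ord0 = a by apply: funext => i /=; rewrite sconsS.
    by split=> // -[b []]; rewrite scons0 => ? ?; apply: nb; exists b.
  have [i hi] := filter_ex Fphi.
  have [N [g [b [Nl ge qE]]]] := realize (h i x).
  have [e be] := elementary_near M_tame b Nl ge.
  have [alpha aP cae] := kP (s ord0) e.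
  have ae := automorphism_elementary aP.
  have [[beta _ bK] _ _ _] := aP.
  pose s' := beta \o s.
  have s'e : alpha \o s' = s by apply: funext => j; rewrite /s' /= bK.
  have /psiP[s1 s2] : sat psi s' by apply/ae; rewrite s'e.
  have s0e : ball k (s' ord0) e by apply/(elementary_ball _ _ _ ae); rewrite /s' /= bK.
  move/(ftrue_split x): hi => /(_ _ s1)[h1|[j]]; last first.
    rewrite /frest; case: asboolP => [_ /type_false//|[]].
    by apply: sphi; exists j.
  have : ~ sat (bex (k + 1) ord0 (fren (fselect x phi) (shift (lift ord0)))) (g \o s').
    move/ge/sat_bex => [d []]; rewrite sat_ren scons_shift => ? ?.
    by apply: s2; exists d.
  apply; apply/sat_bex; exists b; split.
    apply: ballD (_ : ball k _ (g e)) _; first exact/(elementary_ball _ _ _ ge).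
    by apply/ball1E; exact: m1_sym.
  by rewrite sat_ren scons_shift; apply/qE.
exists q => phi Fphi sphi.
pose g y := if `[< y = x >] then q else p0.
have gx : g x = q by rewrite /g; case: asboolP.
apply: (eq_ftrue (h := g)); first by move=> y /sphi ->.
apply: qP => // y yx.
by rewrite /g; case: asboolP.
Qed.

Lemma hom_limit (M M' : structure L) I X (F : set_system I) (FF : ProperFilter F)
    (h : I -> X -> type_space M) (x : X) :
  local_model T M -> orbit_bounded M -> local_model T M' ->
  (forall B : set X, B !=set0 ->
     (forall y z, B z -> F [set i | mu1 (h i y) (h i z)] -> B y) -> forall y, B y) ->
  exists f : X -> type_space M', forall phi, F [set i | ftrue (h i) phi] -> ftrue f phi.
Proof.
move=> TM oM TM' conn; have [q qP] := base_point FF h x TM oM TM'.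
have [||f [_ fP]] := @hom_extend _ _ _ (T_tame TM) (T_tame TM') _ _ F h _ [set x] (fun=> q).
- exact: qP.
- by move=> B xB Bmu; apply: conn => //; exists x; exact: xB.
by exists f.
Qed.

Lemma type_space_hom (M M' : structure L) :
  local_model T M -> orbit_bounded M -> local_model T M' ->
  exists h : type_space M -> type_space M', phom h.
Proof.
move=> TM oM TM'; have [c] := dom_inh M.
have [|f fP] := @hom_limit M M' _ _ _ (principal_filter_proper tt)
    (fun=> id) (tp (T_tame TM) c) TM oM TM'.
  move=> B B0 Bmu; apply: (type_connected (T_tame TM)) => // p q Bq pq.
  by apply: Bmu Bq _; apply/principal_filterP.
by exists f => t p tp; apply: (fP (Fact t p)); apply/principal_filterP.
Qed.

Section MaximalRigid.
Variable M : structure L.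
Hypotheses (TM : local_model T M) (oM : orbit_bounded M).
Let M_tame := T_tame TM.
Let S : pstruct L := type_space M.

(** Maps are total on S and only facts with points in J are tested, so partial homomorphisms need no
    subtypes. *)
Let hom_on (J : set S) (f : S -> S) :=
  forall phi, fsupp phi `<=` J -> ftrue id phi -> ftrue f phi.

Definition rigid (J : set S) := forall f : S -> S, hom_on J f ->
  forall phi, fsupp phi `<=` J -> ftrue f phi -> ftrue id phi.

Let phomP (f : S -> S) : phom f <-> forall phi, ftrue id phi -> ftrue f phi.
Proof. by split=> [h phi|h t p tp]; [exact: h|exact: (h (Fact t p))]. Qed.

Let Sconn (B : set S) : B !=set0 -> (forall p q, B q -> mu1 p q -> B p) -> forall p, B p.
Proof. exact: (type_connected M_tame). Qed.

(** Zorn: a chain is bounded by its limit along the filter of end segments, because a fact true at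
    one stage remains true at all later ones. *)
Lemma max_hom (J : set S) : exists h : S -> S,
  [/\ phom h, forall x, J x -> h x = x &
     forall g : S -> S, phom g -> (forall x, J x -> g x = x) ->
       (forall phi, ftrue h phi -> ftrue g phi) -> forall phi, ftrue g phi -> ftrue h phi].
Proof.
pose P (h : S -> S) := phom h /\ forall x, J x -> h x = x.
have Pid : P id by split=> // t p.
pose R (s t : {h | P h}) := `[< forall phi, ftrue (sval s) phi -> ftrue (sval t) phi >].
have Rxx s : R s s by apply/asboolP.
have Rtr r s t : R r s -> R s t -> R r t.
  by move=> /asboolP rs /asboolP st; apply/asboolP => phi /rs/st.
have [C Ctot|[h [hh hJ]] hmax] := @ZL_preorder _ (exist _ _ Pid) R Rxx Rtr; last first.
  exists h; split=> // g gh gJ hg phi gphi.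
  have /asboolP := hmax (exist _ g (conj gh gJ)) (asboolT hg).
  exact.
have [->|/set0P[s0 Cs0]] := eqVneq C set0; first by exists (exist _ _ Pid).
pose D (i : {s | C s}) := [set j : {s | C s} | R (sval i) (sval j)].
pose F := filter_from setT D.
have FF : ProperFilter F.
  apply: filter_from_proper; last by move=> i _; exists i; exact: Rxx.
  apply: filter_fromT_filter; first by exists (exist _ s0 Cs0).
  move=> [i Ci] [j Cj]; have [ij|ji] := Ctot _ _ Ci Cj.
    by exists (exist _ j Cj) => k jk; split=> //; exact: Rtr jk.
  by exists (exist _ i Ci) => k ik; split=> //; exact: Rtr ik.
pose h (i : {s | C s}) : S -> S := sval (sval i).
have hP i : P (h i) := svalP (sval i).
have FT phi : ftrue id phi -> F [set i | ftrue (h i) phi].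
  move=> tphi; apply: filterS (@filterT _ F _) => i _.
  by have [/phomP + _] := hP i; apply.
have conn (B : set S) : B !=set0 ->
    (forall x y, B y -> F [set i | mu1 (h i x) (h i y)] -> B x) -> forall x, B x.
  move=> B0 Bmu; apply: Sconn B0 _ => p q Bq pq; apply: Bmu Bq _.
  by apply: filterS (@filterT _ F _) => i _; apply: mu1_phom pq; case: (hP i).
suff [f [fJ fP]] : exists f : S -> S, (forall x, J x -> f x = x) /\
    forall phi, F [set i | ftrue (h i) phi] -> ftrue f phi.
  have Pf : P f by split=> //; apply/phomP => phi /FT/fP.
  exists (exist _ f Pf) => s Cs; apply/asboolP => phi sphi /=.
  apply: fP; exists (exist _ s Cs) => // j /asboolP; exact.
(* Extension from J needs a point of J to start from; when there is none, a base point has to be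
   found. *)
have [J0|/set0P J0] := eqVneq J set0.
  have [c] := dom_inh M.
  have [f fP] := hom_limit FF (tp M_tame c) TM oM TM conn.
  by exists f; split=> // x; rewrite J0.
apply: (hom_extend M_tame M_tame) => [phi Fphi sphi|B JB]; last first.
  by apply: conn; have [x Jx] := J0; exists x; exact: JB.
have [i hi] := filter_ex Fphi.
apply: eq_ftrue hi => x /sphi Jx.
by have [_ ->] := hP i.
Qed.

(** Rigidity makes the inverse of f on the image of J well defined and fact-preserving; it then
    extends to all of S. *)
Lemma rigid_inverse (J : set S) (f : S -> S) : rigid J -> hom_on J f ->
  exists2 g : S -> S, phom g & forall x, J x -> g (f x) = x.
Proof.
move=> Jr fh; have [J0|/set0P J0] := eqVneq J set0.
  by exists id => // x; rewrite J0.
have finj x y : J x -> J y -> f x = f y -> x = y.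
  by move=> Jx Jy; apply: (facts_inj (h' := id) (Jr f fh) Jx Jy).
have /choice[f0 f0P] y : exists x, forall z, J z -> f z = y -> x = z.
  have [[x Jx xy]|nx] := pselect (exists2 x, J x & f x = y); last first.
    by exists y => z Jz zy; case: nx; exists z.
  by exists x => z Jz zy; apply: finj => //; rewrite xy.
have [||g [gA gP]] := @hom_extend _ _ _ M_tame M_tame unit S _ (fun=> id)
  (principal_filter_proper tt) (f @` J) f0.
- move=> [t p] /principal_filterP tp sp.
  have /choice[u uP] i : exists x, J x /\ f x = p i.
    by have [|x Jx xp] := sp (p i); [exists i|exists x].
  have fu : p = f \o u by apply: funext => i; case: (uP i).
  have : ftrue id (Fact t u).
    apply: (Jr f fh) => [_ [i _ <-]|]; first by case: (uP i).
    by move: tp; rewrite fu.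
  rewrite /ftrue (_ : f0 \o p = id \o u) //; apply: funext => i /=.
  by case: (uP i) => *; exact: f0P.
- move=> B AB Bmu; apply: Sconn.
    by have [x Jx] := J0; exists (f x); apply: AB; exists x.
  by move=> p q Bq pq; apply: Bmu Bq _; apply/principal_filterP.
exists g; first by apply/phomP => phi tphi; apply: gP; apply/principal_filterP.
by move=> x Jx; rewrite gA; [exact: f0P|exists x].
Qed.

(* For J maximal rigid and h maximal among the homomorphisms fixing J, the
   image of h is rigid, hence equal to J. *)
Lemma rigid_retract : exists (J : set S) (h : S -> S),
  [/\ rigid J, phom h, forall x, J x -> h x = x & forall x, J (h x)].
Proof.
have [Fs sF Ftot|J [Jr Jmax]] := @Zorn_bigcup S rigid.
  move=> f fh phi sphi.
  have [Fs0|/set0P F0] := eqVneq Fs set0.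
    rewrite Fs0 bigcup_set0 in sphi; apply: eq_ftrue => x /sphi [].
  pose R (A B : set S) := `[< A `<=` B >].
  have /choice[A AP] i : exists A, Fs A /\ A (fpt phi i).
    by have [|A FA Ai] := sphi (fpt phi i); [exists i|exists A].
  have [||B FB BP] := @chain_bound _ R Fs _ A _ _ F0 (fun i => proj1 (AP i)).
  - by move=> r s t /asboolP rs /asboolP st; apply/asboolP; exact: subset_trans st.
  - by move=> s t Fs' Ft; have [?|?] := Ftot _ _ Fs' Ft; [left|right]; exact/asboolP.
  apply: (sF _ FB) => [psi spsi|_ [i _ <-]].
    by apply: fh => x /spsi Bx; exists B.
  by have /asboolP := BP i; apply; case: (AP i).
have [h [hh hJ hmax]] := max_hom J.
exists J, h; split=> // x.
suff Rr : rigid (range h).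
  apply: contrapT => nJx; apply: (Jmax (range h)) => //; split.
    by move=> y Jy; exists y => //; exact: hJ.
  by move=> /(_ (h x) (ex_intro2 _ _ x I erefl)).
move=> f fh.
have fhh : phom (f \o h).
  move=> t p tp; apply: (fh (Fact t (h \o p))) => [_ [i _ <-]|]; first by exists (p i).
  exact: hh.
have [g gh gf] : exists2 g : S -> S, phom g & forall x, J x -> g (f x) = x.
  apply: rigid_inverse => // phi sphi; apply: fh => y /sphi Jy.
  by exists y => //; exact: hJ.
move=> [t p] sp fp.
have /choice[u uP] i : exists y, h y = p i.
  by have [|y _ yp] := sp (p i); [exists i|exists y].
have pu : p = h \o u by apply: funext => i; rewrite /= uP.
(* [g \o f \o h] fixes J and keeps every fact of h, so by maximality it has no others; a fact
   holding only after f would be one. *)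
rewrite pu; apply: (hmax (g \o f \o h) _ _ _ (Fact t u)).
- exact: phom_comp gh fhh.
- by move=> y Jy /=; rewrite hJ // gf.
- move=> [t' p'] hp'; apply: gh; apply: (fh (Fact t' (h \o p'))) => //.
  by move=> _ [i _ <-]; exists (p' i).
by apply: gh; move: fp; rewrite pu.
Qed.

End MaximalRigid.

Lemma core_exists (M0 : structure L) : local_model T M0 -> orbit_bounded M0 ->
  exists J : pstruct L, is_core T J.
Proof.
move=> TM0 oM0; have [J [h [Jr hh hJ Jh]]] := rigid_retract TM0 oM0.
pose C := @PStruct L {x | J x} (fun t p => Def (fun i => sval (p i))).
pose hC x : C := exist _ (h x) (Jh x).
(* Every homomorphism from C to a type space has a retraction: return to S(M0) by [b], undo the
   composite on J, then apply h. The three clauses follow, since a homomorphism with a retraction is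
   an embedding. *)
have Chom (M : structure L) (TM : local_model T M) (oM : orbit_bounded M)
    (j : C -> type_space M) : phom j ->
    exists2 r : type_space M -> C, phom r & cancel j r.
  move=> jh; have [b bh] := type_space_hom TM oM TM0.
  have [|g gh gP] := rigid_inverse TM0 Jr (f := b \o j \o hC).
  - move=> [t p] sp tp; apply/bh/jh.
    have e : (fun i => sval (hC (p i))) = p.
      by apply: funext => i /=; apply: hJ; apply: sp; exists i.
    by change (Def (t := t) (fun i => sval (hC (p i)))); rewrite e.
  exists (hC \o g \o b).
    by move=> t p tp; apply/hh/gh/bh.
  move=> [x Jx]; have hx : hC x = exist _ x Jx by exact/sig_eq/hJ.
  by rewrite -{1}hx /=; apply: sig_eq; rewrite /= gP // hJ.
exists C; split=> [M TM oM|M TM oM j [_ jP]|M TM oM j jh].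
- have [b bh] := type_space_hom TM0 oM0 TM.
  have jh : phom (b \o sval : C -> type_space M) by move=> t p tp; exact: bh.
  exists (b \o sval); have [r rh rK] := Chom M TM oM _ jh.
  split=> [|t p]; first exact: can_inj rK.
  split; first exact: jh.
  move=> /rh; rewrite (_ : r \o _ = p) //.
  by apply: funext => i /=; exact: rK.
- by apply: Chom => // t p /jP.
have [r rh rK] := Chom M TM oM _ jh.
split=> [|t p]; first exact: can_inj rK.
split; first exact: jh.
move=> /rh; rewrite (_ : r \o _ = p) //.
by apply: funext => i /=; exact: rK.
Qed.

End Core.

(** * Quantifier elimination and uniqueness *)

Lemma psat_phom L (J K : pstruct L) (h : J -> K) n (phi : ppfml L n) (p : 'I_n -> J) :
  phom h -> psat phi p -> psat phi (h \o p).
Proof.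
move=> hh; elim: phi p => {n} [n [t v|i j]|n phi IH psi IH'|n i phi IH] p /=.
- exact: hh.
- by move=> ->.
- by move=> [/IH ? /IH'].
move=> [x [xp sx]]; exists (h x); split; first exact: mu1_phom.
by rewrite -comp_scons; exact: IH.
Qed.

Lemma psat_retract L (J K : pstruct L) (j : J -> K) (r : K -> J) n (phi : ppfml L n)
    (p : 'I_n -> J) :
  phom j -> phom r -> cancel j r -> psat phi p <-> psat phi (j \o p).
Proof.
move=> hj hr rj; split=> [|/(psat_phom hr)]; first exact: psat_phom.
by rewrite (_ : r \o _ = p) //; apply: funext => i /=; rewrite rj.
Qed.

(** Homomorphisms in both directions preserve pp formulas, so their truth at tuples of J is the same
    in K, and negations follow. This gives reflection. *)
Lemma bsat_retract L (J K : pstruct L) (j : J -> K) (r : K -> J) n (R : bppfml L n)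
    (p : 'I_n -> J) :
  phom j -> phom r -> cancel j r -> bsat R p <-> bsat R (j \o p).
Proof.
move=> hj hr rj; elim: R => [phi|R IH|R IH R' IH'|R IH R' IH'] /=.
- exact: psat_retract hj hr rj.
- by rewrite IH.
- by rewrite IH IH'.
- by rewrite IH IH'.
Qed.

Section QuantifierElimination.
Variables (L : language).

Lemma pp_facts n (phi : ppfml L n) : exists Th : set (fact L 'I_n),
  forall M : structure L, tame M -> forall p : 'I_n -> type_space M,
    psat phi p <-> forall f, Th f -> ftrue p f.
Proof.
elim: phi => {n} [n [t v|i j]|n phi [Th IH] psi [Th' IH']|n i phi [Th IH]].
- by exists [set Fact t v] => M _ p; split=> [sp f ->//|H]; exact: (H (Fact t v)).
- exists [set f | exists m (phi : fml L m.+1), f = eqfact i j phi] => M _ p /=.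
  split=> [e f [m [phi ->]]|H]; first by apply/ftrue_eqfact; rewrite e.
  by apply: type_eqP => m phi; apply/ftrue_eqfact/H; exists m, phi.
- exists (Th `|` Th') => M tM p /=; rewrite (IH M tM) (IH' M tM).
  by split=> [[H H'] f [/H|/H']|H] //; split=> f Tf; apply: H; [left|right].
pose x0 := lift ord0 i.
(* All demands on the bound variable, mu_1 included, closed under [fcomb] as one-point elimination
   requires. *)
pose cl : set (fact L 'I_n.+1) := [set f | forall P : set (fact L 'I_n.+1),
  Th `<=` P -> P (mufact L ord0 x0) ->
  (forall f1 f2, P f1 -> P f2 -> P (fcomb ord0 f1 f2)) -> P f].
(* Variable 0 no longer occurs after elimination, so its value i is a mere default. *)
pose g (k : 'I_n.+1) := odflt i (unlift ord0 k).
have gl k : g (lift ord0 k) = k by rewrite /g liftK.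
exists [set fact_map g (felim ord0 x0 f) | f in cl] => M tM p.
split=> [[x [xp /(IH M tM) sx]] _ [f clf <-]|H].
  have fx : ftrue (scons x p) f.
    apply: clf => // [|f1 f2]; last exact: ftrue_comb.
    by apply/ftrue_mufact; rewrite scons0 sconsS.
  have : ftrue (scons x p) (felim ord0 x0 f).
    by apply: ftrue_elim => //; rewrite scons0 sconsS.
  change (ftrue (scons x p) (felim ord0 x0 f) -> ftrue (p \o g) (felim ord0 x0 f)).
  apply: eq_ftrue => y fy; have [k ->] : exists k, y = lift ord0 k.
    have [->|[y0 _]] := fsupp_elim fy; first by exists i.
    by case: (unliftP ord0 y) y0 => [k|] ->; [exists k|].
  by rewrite /= gl sconsS.
have [||q qP] := @fact_elim _ _ tM _ ord0 x0 cl (p \o g).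
- move=> f1 f2 c1 c2 P TP mP cP.
  by apply: (cP); [exact: c1|exact: c2].
- by move=> f clf; apply: (H (fact_map g (felim ord0 x0 f))); exists f.
have clP f : cl f -> ftrue (scons q p) f.
  apply: qP; first exact: scons0.
  by move=> y; case: (unliftP ord0 y) => [k|] -> // _; rewrite sconsS /= gl.
exists q; split.
  have /ftrue_mufact : ftrue (scons q p) (mufact L ord0 x0) by apply: clP => P ? ?.
  by rewrite scons0 sconsS.
by apply/(IH M tM) => f Tf; apply: clP => P TP _ _; exact: TP.
Qed.

End QuantifierElimination.

(** * Uniqueness, endomorphisms and orbits of the core *)

Section AbstractCore.
Variables (L : language) (T : theory L) (M : structure L).
Hypotheses (TM : local_model T M) (oM : orbit_bounded M).

(** Followed by an embedding of J' into S(M), f becomes an embedding by rigidity of J, so the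
    composite has a retraction. *)
Lemma core_hom_inverse (J J' : pstruct L) (f : J -> J') :
  is_core T J -> is_core T J' -> phom f -> exists2 g : J' -> J, phom g & cancel f g.
Proof.
move=> cJ cJ' hf; have [j' [_ j'P]] := core_embeds cJ' TM oM.
have hj' : phom j' by move=> t p /j'P.
have jf : pembedding (j' \o f) by apply: (core_rigid cJ TM oM); exact: phom_comp.
have [r hr rK] := core_retract cJ TM oM jf.
by exists (r \o j'); [exact: phom_comp|].
Qed.

Lemma core_hom_iso (J J' : pstruct L) (f : J -> J') :
  is_core T J -> is_core T J' -> phom f ->
  exists g : J' -> J, [/\ phom g, cancel f g & cancel g f].
Proof.
move=> cJ cJ' hf; have [g hg fK] := core_hom_inverse cJ cJ' hf.
have [g' _ gK] := core_hom_inverse cJ' cJ hg.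
by exists g; split=> // y; apply: (can_inj gK); rewrite fK.
Qed.

Lemma core_unique (J J' : pstruct L) : is_core T J -> is_core T J' -> pisomorphic J J'.
Proof.
move=> cJ cJ'; have [j [_ jP]] := core_embeds cJ TM oM.
have [j' j'e] := core_embeds cJ' TM oM.
have [r hr _] := core_retract cJ' TM oM j'e.
have hf : phom (r \o j) by apply: phom_comp => // t p /jP.
have [g [hg fK gK]] := core_hom_iso cJ cJ' hf.
exists (r \o j); first by exists g.
split=> [|t p]; first exact: can_inj fK.
split=> [/hf//|/hg]; rewrite (_ : g \o _ = p) //.
by apply: funext => i; exact: fK.
Qed.

Variable J : pstruct L.
Hypotheses (J_core : is_core T J) (M_tame : tame M).

Lemma core_aut (g : J -> J) : phom g -> exists a : aut J, forall x, a x = g x.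
Proof.
move=> hg; have [g' [hg' gK g'K]] := core_hom_iso J_core J_core hg.
have gP (t : pattern L) (p : 'I_(parity t) -> J) : Def p <-> Def (g \o p).
  split=> [/hg//|/hg']; rewrite (_ : g' \o _ = p) //.
  by apply: funext => i; exact: gK.
by exists (Aut g'K gK gP).
Qed.

Lemma core_connected (B : set J) : B !=set0 ->
  (forall x y, B y -> mu1 x y -> B x) -> forall x, B x.
Proof.
move=> [b Bb] Bmu x; have [j je] := core_embeds J_core TM oM.
have [r hr rK] := core_retract J_core TM oM je.
rewrite -(rK x); apply: (type_connected M_tame (B := [set p | B (r p)])).
  by exists (j b); rewrite /= rK.
by move=> p q Bq pq; apply: Bmu Bq _; exact: mu1_phom.
Qed.

(** J is a retract of S(M): extend inside S(M), then retract. *)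
Lemma core_extend I X (F : set_system I) (FF : Filter F) (u : I -> X -> J)
    (A : set X) (g0 : X -> J) :
  (forall phi, F [set i | ftrue (u i) phi] -> fsupp phi `<=` A -> ftrue g0 phi) ->
  (forall B : set X, A `<=` B ->
     (forall x y, B y -> F [set i | mu1 (u i x) (u i y)] -> B x) -> forall x, B x) ->
  exists g : X -> J, (forall x, A x -> g x = g0 x) /\
    forall phi, F [set i | ftrue (u i) phi] -> ftrue g phi.
Proof.
move=> g0P conn; have [j je] := core_embeds J_core TM oM.
have [r hr rK] := core_retract J_core TM oM je.
have jP (v : X -> J) phi : ftrue (j \o v) phi <-> ftrue v phi.
  by rewrite [ftrue v phi](proj2 je).
have [||f [fA fP]] := @hom_extend _ _ _ M_tame M_tame I X F (fun i => j \o u i) _ A (j \o g0).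
- move=> phi Fphi sphi; apply/jP/g0P => //.
  by apply: filterS Fphi => i /= /jP.
- move=> B AB Bmu; apply: conn => // x y By Fmu; apply: Bmu By _.
  apply: filterS Fmu => i /= xy.
  by apply/(ftrue_mufact (j \o u i) x y)/jP/(ftrue_mufact (u i) x y).
exists (r \o f); split=> [x Ax|phi Fphi]; first by rewrite /= fA //= rK.
by apply: (phom_ftrue hr); apply: fP; apply: filterS Fphi => i /= /jP.
Qed.

(** Sending each [a i] to [b i] is a partial homomorphism, well defined by the equality atoms; it
    extends to an endomorphism of J, hence an automorphism. *)
Lemma core_orbits n (a b : 'I_n -> J) :
  (forall gamma : atom L n, asat gamma a <-> asat gamma b) <->
  (exists g : aut J, forall i, b i = g (a i)).
Proof.
split=> [ab|[g gP] gamma]; last first.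
  have := psat_aut g (PAtom gamma) a; rewrite /= (_ : _ \o a = b) //.
  by apply: funext => i; rewrite gP.
(* Connectedness needs one entry of the tuple to start from. *)
have [n0|n_gt0] := posnP n.
  by exists (1%g : aut J) => i; have := ltn_ord i; rewrite [X in (_ < X)%N]n0.
have ab_eq i k : a i = a k -> b i = b k by move/(ab (AEq L i k)).
have /choice[g0 g0P] x : exists y, forall i, a i = x -> y = b i.
  have [[i ix]|nx] := pselect (exists i, a i = x).
    by exists (b i) => k kx; apply: ab_eq; rewrite ix.
  by exists x => i ix; case: nx; exists i.
have [||g [gA gP]] := @core_extend unit J _ (principal_filter_proper tt) (fun=> id) (range a) g0.
- move=> [t p] /principal_filterP tp sp.
  have /choice[v vP] k : exists i, a i = p k.
    by have [|i _ ip] := sp (p k); [exists k|exists i].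
  have pv : p = a \o v by apply: funext => k; rewrite /= vP.
  have : asat (@ADef L n t v) a by move: tp; rewrite pv.
  move/ab; rewrite /ftrue /= (_ : g0 \o p = b \o v) //.
  by apply: funext => k /=; apply: g0P; exact: vP.
- move=> B AB Bmu; apply: core_connected.
    by exists (a (Ordinal n_gt0)); apply: AB; exists (Ordinal n_gt0).
  by move=> x y By xy; apply: Bmu By _; apply/principal_filterP.
have [|alpha alphaP] := core_aut (g := g).
  by move=> t p tp; apply: (gP (Fact t p)); apply/principal_filterP.
by exists alpha => i; rewrite alphaP gA ?(g0P _ i) //; exists i.
Qed.

Lemma core_pp_facts n (phi : ppfml L n) : (forall N, local_model T N -> tame N) ->
  exists Th : set (fact L 'I_n),
  (forall N : structure L, local_model T N -> forall p : 'I_n -> type_space N,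
     psat phi p <-> forall f, Th f -> ftrue p f) /\
  (forall p : 'I_n -> J, psat phi p <-> forall f, Th f -> ftrue p f).
Proof.
move=> T_tame; have [Th ThP] := pp_facts phi; exists Th; split=> [N /T_tame|p].
  exact: ThP.
have [j je] := core_embeds J_core TM oM; have [_ jP] := je.
have [r hr rK] := core_retract J_core TM oM je.
have hj : phom j by move=> t q /jP.
rewrite (psat_retract phi p hj hr rK) (ThP M M_tame).
by split=> H f /H; rewrite /ftrue jP.
Qed.

Lemma core_elimination n (phi : ppfml L n) : (forall N, local_model T N -> tame N) ->
  exists Gamma : set (atom L n),
  (forall N : structure L, local_model T N -> forall p : 'I_n -> type_space N,
     psat phi p <-> forall gamma, Gamma gamma -> asat gamma p) /\
  (forall p : 'I_n -> J, psat phi p <-> forall gamma, Gamma gamma -> asat gamma p).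
Proof.
move=> /(core_pp_facts phi)[Th [ThN ThJ]].
exists [set @ADef L n (fpat f) (fpt f) | f in Th]; split=> [N TN p|p]; rewrite ?(ThN _ TN) ?ThJ.
  by split=> [H _ [f /H ? <-//]|H f Tf]; apply: (H (@ADef L n (fpat f) (fpt f))); exists f.
by split=> [H _ [f /H ? <-//]|H f Tf]; apply: (H (@ADef L n (fpat f) (fpt f))); exists f.
Qed.

End AbstractCore.

(** * The topology of the automorphism group *)

Section Subbase.
Variables (U : topologicalType) (D : set (set U)).

Lemma subbase_cvg (F : set_system U) {FF : Filter F} (x : U) :
  (forall A, open A -> exists2 E : set (set U), E `<=` finI_from D id &
     \bigcup_(B in E) B = A) ->
  (forall B, D B -> B x -> F B) -> F --> x.
Proof.
move=> opE DF A; rewrite nbhsE => -[B [/opE[E sE <-] [C EC Cx]] sB].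
have FC : F C.
  have [G sG CE] := sE _ EC; rewrite -CE.
  apply: filter_bigI => H HG; apply: DF; first by have := sG _ HG; rewrite inE.
  by move: Cx; rewrite -CE; apply.
by apply: filterS FC => y Cy; apply: sB; exists C.
Qed.

Lemma subbase_open (B : set U) :
  (forall E : set (set U), E `<=` finI_from D id -> open (\bigcup_(A in E) A)) ->
  D B -> open B.
Proof.
move=> opE DB; have := opE [set B]; rewrite bigcup_set1; apply=> _ ->.
exact: (@finI_from1 _ _ D id B DB).
Qed.

End Subbase.

Section AutTopology.
Variables (L : language) (J : pstruct L).

Lemma aut_cvg (F : set_system (aut J)) {FF : Filter F} (g : aut J) :
  (forall t n (c : 'I_(parity t) -> J), ~ Wset n c g -> F (~` Wset n c)) -> F --> g.
Proof.
move=> FW; apply: (@subbase_cvg _ [set U | exists t n (c : 'I_(parity t) -> J),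
  ~` U = Wset n c]) => [A [E sE EA]|B [t [n [c BW]]] Bg]; first by exists E.
by rewrite -(setCK B) BW; apply: FW; rewrite -BW => /(_ Bg).
Qed.

Lemma closed_Wset t n (c : 'I_(parity t) -> J) : closed (Wset n c).
Proof.
rewrite -openC; apply: (@subbase_open _ [set U | exists t n (c : 'I_(parity t) -> J),
  ~` U = Wset n c]) => [E sE|]; first by exists E.
by exists t, n, c; rewrite setCK.
Qed.

Lemma pptop_cvg (F : set_system (pptop J)) {FF : Filter F} (x : pptop J) :
  (forall A, ppdef (J := J) A -> ~ A x -> F (~` A)) -> F --> x.
Proof.
move=> FA; apply: (@subbase_cvg _ [set U : set (pptop J) | ppdef (J := J) (~` U)])
  => [A [E sE EA]|B BW Bx]; first by exists E.
by rewrite -(setCK B); apply: FA => // /(_ Bx).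
Qed.

(* Two kinds of points of J: (e, x) stands for g_e x, and x for itself. *)
Definition moved (E : Type) (g : E -> aut J) (z : (E * J) + J) : J :=
  match z with inl ex => g ex.1 ex.2 | inr x => x end.

Definition moved1 (g : aut J) := moved (fun _ : unit => g).

Lemma ftrue_Wset t n (c : 'I_(parity t) -> J) (g : aut J) : Wset n c g <->
  ftrue (moved1 g)
    (Fact t (fun i : 'I_(parity t) => if i < n then inl (tt, c i) else inr (c i))).
Proof.
rewrite /ftrue /Wset /=.
rewrite (_ : _ \o _ = (fun i : 'I_(parity t) => if i < n then g (c i) else c i)) //.
by apply: funext => i /=; case: ifP.
Qed.

End AutTopology.

Section CoreTopology.
Variables (L : language) (T : theory L) (M : structure L) (J : pstruct L).
Hypotheses (T_tame : forall N, local_model T N -> tame N).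
Hypotheses (TM : local_model T M) (oM : orbit_bounded M) (J_core : is_core T J).
Let M_tame := T_tame TM.

(** [Wset] moves an initial segment of the arguments; any mixture of moved and fixed points reduces
    to that form. Embedding J in S(M) gives [Def] the meaning under which a False formula adds
    nothing. *)
Lemma closed_moved (phi : fact L ((unit * J) + J)) :
  closed [set g : aut J | ftrue (moved1 g) phi].
Proof.
case: phi => t p; have [j [_ jP]] := core_embeds J_core TM oM.
pose n := parity t.
pose val i := match p i with inl ex => ex.2 | inr x => x end.
(* Each point is listed twice, among the moved and among the fixed arguments,
   and the copy in the wrong list carries the formula False. *)
pose t' := @Pattern L (n + n) (pparams t) (fun i => match fintype.split i with
  | inl k => if p k is inl _ then pphi k else FFalse
  | inr k => if p k is inr _ then pphi k else FFalse end) (palpha t).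
pose c (i : 'I_(n + n)) := match fintype.split i with inl k => val k | inr k => val k end.
rewrite (_ : mkset _ = @Wset L J t' n c); first exact: closed_Wset.
apply/seteqP; split=> g; rewrite /= /ftrue /Wset /mkset !jP => H a /H [i hi].
  case e : (p i) hi => [[u x]|x] /= hi; rewrite /= e /= in hi.
    exists (lshift n i); rewrite /= (unsplitK (inl i)) e /c.
    by rewrite (unsplitK (inl i)) /val e ltn_ord.
  exists (rshift n i); rewrite /= (unsplitK (inr i)) e /c.
  by rewrite (unsplitK (inr i)) /val e ltnNge leq_addr.
move: hi; rewrite /= /c -[i]splitK; case: (fintype.split i) => k /=.
  rewrite !(unsplitK (inl k)) ltn_ord /val.
  by case e : (p k) => [[u x]|x] hi; [exists k; rewrite /= e|case: (type_false hi)].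
rewrite !(unsplitK (inr k)) ltnNge leq_addr /= /val.
by case e : (p k) => [[u x]|x] hi; [case: (type_false hi)|exists k; rewrite /= e].
Qed.

Lemma continuous_into_aut (f : aut J -> aut J) :
  (forall phi, exists psi : fact L ((unit * J) + J), forall g,
     ftrue (moved1 (f g)) phi <-> ftrue (moved1 g) psi) ->
  continuous f.
Proof.
move=> fP g; have Fg : Filter (nbhs g) := nbhs_filter g.
have FF : Filter (f @ g) by typeclasses eauto.
apply: (@aut_cvg _ _ _ FF) => t n c /ftrue_Wset ng.
have [psi psiP] := fP (Fact t
  (fun i : 'I_(parity t) => if i < n then inl (tt, c i) else inr (c i))).
apply: open_nbhs_nbhs; split; last by rewrite /= ftrue_Wset.
rewrite (_ : _ @^-1` _ = ~` [set h | ftrue (moved1 h) psi]).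
  by rewrite openC; exact: closed_moved.
by apply/seteqP; split=> h /=; rewrite ftrue_Wset psiP.
Qed.

Lemma ftrue_aut X (g : aut J) (h : X -> J) (phi : fact L X) :
  ftrue h phi <-> ftrue (g \o h) phi.
Proof. by rewrite /ftrue (aut_Def g). Qed.

Lemma autM_continuousl (h : aut J) : continuous (fun g : aut J => (h * g)%g).
Proof.
apply: continuous_into_aut => phi.
exists (fact_map (fun z => match z with inl ex => inl ex | inr x => inr (aut_inv h x) end) phi).
move=> g; rewrite [X in _ <-> X](ftrue_aut h).
rewrite /ftrue /fact_map /= (_ : _ \o _ = h \o moved1 g \o
  (fun z => match z with inl ex => inl ex | inr x => inr (aut_inv h x) end) \o fpt phi) //.
by apply: funext => i /=; case: (fpt phi i) => [[u x]|x] //=; rewrite aut_invK.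
Qed.

Lemma autM_continuousr (h : aut J) : continuous (fun g : aut J => (g * h)%g).
Proof.
apply: continuous_into_aut => phi.
exists (fact_map (fun z => match z with inl ex => inl (tt, h ex.2) | inr x => inr x end) phi).
move=> g; rewrite /ftrue /fact_map /= (_ : _ \o _ = moved1 g \o
  (fun z => match z with inl ex => inl (tt, h ex.2) | inr x => inr x end) \o fpt phi) //.
by apply: funext => i /=; case: (fpt phi i) => [[u x]|x].
Qed.

(** Applying g to the whole fact exchanges the roles: g^-1 x and y become x and g y. *)
Lemma autV_continuous : continuous (fun g : aut J => (g^-1)%g).
Proof.
apply: continuous_into_aut => phi.
exists (fact_map (fun z => match z with inl ex => inr ex.2 | inr x => inl (tt, x) end) phi).
move=> g; rewrite [X in X <-> _](ftrue_aut g).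
rewrite /ftrue /fact_map /= (_ : _ \o _ = moved1 g \o
  (fun z => match z with inl ex => inr ex.2 | inr x => inl (tt, x) end) \o fpt phi) //.
by apply: funext => i /=; case: (fpt phi i) => [[u x]|x] //=; rewrite aut_invK.
Qed.

(** Quantifier elimination links the two topologies: a pp-definable closed set pulls back to an
    intersection of sets given by facts. *)
Lemma eval_continuous (a : J) : continuous (fun g : aut J => g a : pptop J).
Proof.
move=> g; have Fg : Filter (nbhs g) := nbhs_filter g.
have FF : Filter ((fun g : aut J => g a : pptop J) @ g) by typeclasses eauto.
apply: (@pptop_cvg _ _ _ FF) => _ [m [phi [c ->]]] nga.
suff cl : closed [set h : aut J | psat phi (scons (h a) c)].
  by apply: open_nbhs_nbhs; split; first exact: closed_openC cl.
have [Th [_ ThP]] := core_pp_facts TM oM J_core M_tame phi T_tame.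
pose s : 'I_m.+1 -> (unit * J) + J := scons (inl (tt, a)) (inr \o c).
have sP (h : aut J) f : ftrue (moved1 h) (fact_map s f) <-> ftrue (scons (h a) c) f.
  by rewrite /ftrue /fact_map /= compA /s comp_scons.
rewrite (_ : mkset _ = \bigcap_(f in Th) [set h | ftrue (moved1 h) (fact_map s f)]).
  by apply: closed_bigI => f _; exact: closed_moved.
apply/seteqP; split=> h /=; first by move=> /ThP H f Tf; apply/sP/H.
by move=> H; apply/ThP => f Tf; apply/sP/H.
Qed.

End CoreTopology.

(** * Limits of automorphisms *)

Section Limits.
Variables (L : language) (T : theory L) (M : structure L) (J : pstruct L).
Hypotheses (T_tame : forall N, local_model T N -> tame N).
Hypotheses (TM : local_model T M) (oM : orbit_bounded M) (J_core : is_core T J).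
Let M_tame := T_tame TM.

(* p and q are far when no c satisfies both m_1(x, c) in p and m_1(x, c) in q.
   Its negation is an open condition implying mu_1. *)
Definition farfact X (x y : X) : fact L X :=
  Fact (@Pattern L 2 1 (fun=> FNot m1_fml) (FTrue L 1))
    (scons x (fun=> y)).

Lemma not_farP X (h : X -> type_space M) x y : ~ ftrue h (farfact x y) <->
  exists c, sval (h x) _ m1_fml (fun _ : 'I_1 => c) /\
    sval (h y) _ m1_fml (fun _ : 'I_1 => c).
Proof.
split=> [nf|[c [xc yc]] /(_ (fun=> c))[]]; last first.
- move=> i; rewrite /= type_not; case: (unliftP ord0 i) => [k|] ->.
    by rewrite sconsS.
  by rewrite scons0.
- by move=> [].
apply: contrapT => /forallNP H; apply: nf => a _.
have ea : a = fun=> a ord0 by apply: funext => i; rewrite [i]ord1.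
have [xc|xc] := pselect (sval (h x) _ m1_fml a).
  exists ord_max; rewrite /= (_ : ord_max = lift ord0 ord0); last exact: val_inj.
  rewrite sconsS type_not => yc; apply: (H (a ord0)).
  by rewrite -ea.
by exists ord0; rewrite /= scons0 type_not.
Qed.

Lemma near_ball (p : type_space M) c d :
  sval p _ m1_fml (fun _ : 'I_1 => c) ->
  sval p _ m1_fml (fun _ : 'I_1 => d) -> ball 2 c d.
Proof.
have [N [f [b [_ fe pE]]]] := realize p.
move=> /pE bc /pE bd; rewrite /= !scons0 !sconsS /= in bc bd.
apply/(elementary_ball _ _ _ fe); exists b; split; first exact: m1_sym.
exact/ball1E.
Qed.

(** Parameters near x and near y are each within 2 of the common c, hence within 4 of each other,
    and mu_1 asks for 5. *)
Lemma not_far_mu1 (x y : J) : ~ ftrue id (farfact x y) -> mu1 x y /\ mu1 y x.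
Proof.
have [j je] := core_embeds J_core TM oM.
have jP phi : ftrue id phi <-> ftrue j phi by rewrite [ftrue id phi](proj2 je).
rewrite jP => /not_farP[c [xc yc]].
have jmu u v : mu1 (j u) (j v) -> mu1 u v.
  by move=> /(ftrue_mufact j u v)/jP/(ftrue_mufact (@id J) u v).
split; apply/jmu/mu1P => a b ha hb.
  apply: (@ballW _ _ (2 + 2)) => //.
  by apply: ballD (near_ball ha xc) (near_ball yc hb).
apply: (@ballW _ _ (2 + 2)) => //.
by apply: ballD (near_ball ha yc) (near_ball xc hb).
Qed.

Lemma not_far_self (x : J) : ~ ftrue id (farfact x x).
Proof.
have [j je] := core_embeds J_core TM oM.
have jP phi : ftrue id phi <-> ftrue j phi by rewrite [ftrue id phi](proj2 je).
by rewrite jP not_farP; have [c] := type_near M_tame (j x); exists c.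
Qed.

Lemma aut_mu1 (g : aut J) x y : mu1 x y <-> mu1 (g x) (g y).
Proof.
rewrite -[mu1 x y]/(mu1 (id x) (id y)) -(ftrue_mufact (@id J) x y) (ftrue_aut g).
exact: (ftrue_mufact g x y).
Qed.

(* Joint limits: several families of automorphisms have simultaneous limits
   satisfying all the facts that hold almost everywhere, including those that
   relate different families. *)
Lemma aut_limit I (F : set_system I) (FF : ProperFilter F) E (u : I -> E -> aut J) :
  (forall e, exists a b, F [set i | mu1 (u i e a) b]) ->
  exists g : E -> aut J, forall phi, F [set i | ftrue (moved (u i)) phi] -> ftrue (moved g) phi.
Proof.
move=> ub; pose g0 (z : (E * J) + J) := match z with inl ex => ex.2 | inr x => x end.
have [||f [fr fP]] := @core_extend _ _ _ TM oM _ J_core M_tame I _ F _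
  (fun i => moved (u i)) (range inr) g0.
- move=> phi /filter_ex[i hi] sphi; apply: eq_ftrue hi => z /sphi[x _ <-] //.
(* The bound puts [(e, a)] next to the fixed b; since automorphisms preserve mu_1, connectedness of
   J then reaches every [(e, x)]. *)
- move=> B AB Bmu [[e x]|x]; last by apply: AB; exists x.
  have [a [b Fab]] := ub e.
  apply: (core_connected TM oM J_core M_tame (B := [set x | B (inl (e, x))])).
    by exists a; apply: (Bmu _ (inr b)) => //; apply: AB; exists b.
  move=> y z Bz yz; apply: Bmu Bz _.
  by apply: filterS (@filterT _ F _) => i _ /=; exact/(aut_mu1 (u i e) y z).
have /choice[g gP] e : exists g : aut J, forall x, g x = f (inl (e, x)).
  apply: (core_aut TM oM J_core) => t p tp.
  apply: (fP (Fact t (fun k => inl (e, p k)))).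
  apply: filterS (@filterT _ F _) => i _.
  exact: (proj1 (aut_Def (u i e) p) tp).
exists g => phi /fP; apply: eq_ftrue => -[[e x]|x] _ /=; first by rewrite gP.
by rewrite fr //; exists x.
Qed.

Lemma limit_cvg I (U : set_system I) (UU : UltraFilter U) (u : I -> aut J) (g : aut J) :
  (forall phi, U [set i | ftrue (moved1 (u i)) phi] -> ftrue (moved1 g) phi) ->
  u @ U --> g.
Proof.
move=> uP; apply: aut_cvg => t n c ng.
have [H|//] := in_ultra_setVsetC (u @^-1` Wset n c) UU.
case: ng; apply/ftrue_Wset/uP; apply: filterS H => i.
by move/ftrue_Wset.
Qed.

(** The condition is the bound that limits require, and is itself a fact, so it passes to the
    limit. *)
Lemma compact_mu1 (a b : J) : compact [set g : aut J | mu1 (g a) b].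
Proof.
rewrite compact_ultra => U UU Uab.
have [|g gP] := @aut_limit _ U _ unit (fun h _ => h).
  by move=> _; exists a, b.
exists (g tt); split.
  apply/(ftrue_mufact (moved g) (inl (tt, a)) (inr b))/gP.
  by apply: filterS Uab => h /= ab; apply/ftrue_mufact.
apply: (@limit_cvg _ U _ id) => phi /gP.
by apply: eq_ftrue => -[[[] x]|x].
Qed.

Lemma open_not_far (a b : J) : open [set g : aut J | ~ ftrue id (farfact (g a) b)].
Proof.
have e (g : aut J) : ftrue (moved1 g) (farfact (inl (tt, a)) (inr b)) <->
    ftrue id (farfact (g a) b).
  by rewrite /ftrue /= !comp_scons.
rewrite (_ : mkset _ = ~` [set g | ftrue (moved1 g) (farfact (inl (tt, a)) (inr b))]).
  by apply: closed_openC; exact: (closed_moved TM oM J_core).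
by apply/seteqP; split=> g /=; rewrite e.
Qed.

Lemma core_inhabited : exists x : J, True.
Proof.
have [j je] := core_embeds J_core TM oM.
have [r _ _] := core_retract J_core TM oM je.
by have [c] := dom_inh M; exists (r (tp M_tame c)).
Qed.

(** The compact set given by mu_1 is defined by a closed condition; the open condition of not being
    far supplies a neighbourhood inside it. *)
Lemma aut_locally_compact : locally_compact_space (aut J).
Proof.
move=> g; have [a _] := core_inhabited.
exists [set h : aut J | mu1 (h a) (g a)]; last exact: compact_mu1.
apply: filterS (_ : [set h : aut J | ~ ftrue id (farfact (h a) (g a))] `<=` _) _.
  by move=> h /= /not_far_mu1[].
apply: open_nbhs_nbhs; split; [exact: open_not_far|exact: not_far_self].
Qed.

Lemma autpi_continuous : continuous (@autpi L J).
Proof. exact: pi_continuous. Qed.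

(** The saturation of V is the union of its right translates by infinitesimals. *)
Lemma autpi_open (V : set (aut J)) : open V -> open (@autpi L J @` V).
Proof.
move=> oV; change (open (@autpi L J @^-1` (@autpi L J @` V))).
rewrite (_ : _ @^-1` _ = \bigcup_(n in @infinitesimal L J)
    ((fun g => (g * n)%g) @^-1` V)).
  apply: bigcup_open => n _.
  by move/continuousP: (@autM_continuousr _ _ _ _ TM oM J_core n); exact.
apply/seteqP; split=> [g [v Vv /autpi_eq vg]|g [n ninf Vgn]].
  exists (g^-1 * v)%g; last by rewrite /= mulgA mulgV mul1g.
  by have := infinitesimalV vg; rewrite invgM invgK.
exists (g * n)%g => //; apply/autpi_eq.
by have := infinitesimalV ninf; rewrite invgM -mulgA mulVg mulg1.
Qed.

Lemma autquo_hausdorff : hausdorff_space (autquo J).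
Proof.
rewrite open_hausdorff => x y /eqP; rewrite -[x]autpi_repr -[y]autpi_repr.
set g1 := repr x; set g2 := repr y => xy.
have : ~ infinitesimal (g1^-1 * g2)%g by move/autpi_eq.
move=> /existsNP[U] /not_implyP[oU] /not_implyP[[a Ua] nU].
pose V := (fun g : aut J => g a : pptop J) @^-1` U.
have oV : open V.
  by move/continuousP: (@eval_continuous _ _ _ _ T_tame TM oM J_core a); exact.
have oVg (g : aut J) : open [set h | V (g^-1 * h)%g].
  by move/continuousP: (@autM_continuousl _ _ _ _ TM oM J_core g^-1%g) => /(_ _ oV).
exists (@autpi L J @` [set h | V (g1^-1 * h)%g], @autpi L J @` [set h | V (g2^-1 * h)%g]).
  by split=> /=; rewrite inE; [exists g1|exists g2] => //=; rewrite mulVg.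
split=> /=; try by apply: autpi_open.
apply/negPn/negP => /set0P[_ [[h1 V1 <-] [h2 V2 /autpi_eq n]]].
set v := (g1^-1 * h1)%g in V1; set w := (g2^-1 * h2)%g in V2.
(* Both v and w send a into U, and h2^-1 h1 is infinitesimal, so it maps some y1 of U1 into U1. Then
   g2^-1 h1 y1 and its image v y1 under g1^-1 g2 both lie in U, against the choice of U. *)
pose U1 : set (pptop J) := (pp_act v @^-1` U) `&` (pp_act w @^-1` U).
have oU1 : open U1 by apply: openI; exact: aut_open.
have [|_ [[y1 [U1y _] <-] [_ U2y]]] := n U1 oU1; first by exists a.
apply: nU; exists (pp_act v y1); split=> //.
exists (pp_act w (pp_act (h2^-1 * h1)%g y1)) => //.
rewrite /pp_act /v /w /=.
by rewrite !aut_invK.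
Qed.

Lemma autquo_locally_compact : locally_compact_space (autquo J).
Proof.
move=> x; rewrite -[x]autpi_repr; have [K gK cK] := aut_locally_compact (repr x).
exists (@autpi L J @` K); last first.
  apply: continuous_compact cK; apply: continuous_subspaceT.
  exact: autpi_continuous.
move: gK; rewrite !nbhsE => -[O [oO gO] OK].
exists (@autpi L J @` O); last by move=> _ [h /OK ? <-]; exists h.
by split; [exact: autpi_open|exists (repr x)].
Qed.

End Limits.

(** * Continuity of the operations of the quotient group *)

Section QuotientGroup.
Variables (L : language) (T : theory L) (M : structure L) (J : pstruct L).
Hypotheses (T_tame : forall N, local_model T N -> tame N).
Hypotheses (TM : local_model T M) (oM : orbit_bounded M) (J_core : is_core T J).
Let pi := @autpi L J.

Lemma autquoV_continuous : continuous (fun x : autquo J => (x^-1)%g).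
Proof.
apply/continuousP => A oA; change (open (pi @^-1` ((fun x : autquo J => (x^-1)%g) @^-1` A))).
rewrite (_ : _ @^-1` _ = (fun g : aut J => (g^-1)%g) @^-1` (pi @^-1` A)).
  by move/continuousP: (autV_continuous TM oM J_core); apply; exact: oA.
by apply/seteqP; split=> g /=; rewrite -[(pi g)^-1%g]/(autquoV (pi g)) /pi autpiV.
Qed.

(* The pairs (g, h) with (pi g, pi h) near (x, y) are bounded, so g^-1 and h
   have simultaneous limits a and b.  The facts about the pair (h, g^-1) include
   those about g h, so g h tends to a^-1 b, where pi a^-1 = x and pi b = y. *)
Lemma autquoM_continuous : continuous (fun x : autquo J * autquo J => (x.1 * x.2)%g).
Proof.
move=> [x y] N /= Nxy; apply: contrapT => nN.
have [c _] := core_inhabited T_tame TM oM J_core.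
set g0 := repr x; set h0 := repr y.
pose near_g := [set g : aut J | ~ ftrue id (farfact L (g c) (g0 c))].
pose near_h := [set h : aut J | ~ ftrue id (farfact L (h c) (h0 c))].
pose pp (p : aut J * aut J) := (pi p.1, pi p.2).
(* Bounded counterexamples near (x, y): if continuity fails, these sets generate a proper filter. *)
pose D (A : set (autquo J * autquo J)) :=
  [set p | [/\ near_g p.1, near_h p.2, A (pp p) & ~ N (pi p.1 * pi p.2)%g]].
have nbhs_pi (g : aut J) (V : set (aut J)) : open V -> V g -> nbhs (pi g) (pi @` V).
  move=> oV Vg; apply: open_nbhs_nbhs; split; last by exists g.
  exact: (autpi_open TM oM J_core oV).
have FD : ProperFilter (filter_from (nbhs (x, y)) D).
  apply: filter_from_proper; last first.
    move=> A Axy; apply: contrapT => nD; apply: nN.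
    have Bxy : nbhs (x, y) ((pi @` near_g) `*` (pi @` near_h)).
      rewrite -[x]autpi_repr -[y]autpi_repr.
      exists (pi @` near_g, pi @` near_h) => //=; split; apply: nbhs_pi.
      - exact: (open_not_far TM oM J_core).
      - exact: (not_far_self T_tame TM oM J_core).
      - exact: (open_not_far TM oM J_core).
      - exact: (not_far_self T_tame TM oM J_core).
    apply: filterS (filterI Axy Bxy) => -[u v] [Auv [[g ng gu] [h nh hv]]].
    rewrite /= in gu hv; apply: contrapT => nNuv; apply: nD; exists (g, h).
    by split=> //=; rewrite /pp /= gu hv.
  apply: filter_from_filter; first by exists setT; exact: filterT.
  move=> A B Axy Bxy; exists (A `&` B); first exact: filterI.
  by move=> p [? ? [? ?] ?]; split; split.
have [U [UU DU]] := ultraFilterLemma FD.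
have PU : ProperFilter U := @ultra_proper _ U UU.
have FU : Filter U := @filter_filter _ _ PU.
have UD A : nbhs (x, y) A -> U (D A) by move=> Axy; apply: DU; exists A.
have UT : U (D setT) by apply: UD; exact: filterT.
have [e|gh ghP] := @aut_limit _ _ _ _ T_tame TM oM J_core _ U PU bool
    (fun p e => if e then p.1^-1 else p.2)%g.
  case: e; [exists (g0 c), c|exists c, (h0 c)]; apply: filterS UT => p [ng nh _ _].
    have [_ /(aut_mu1 p.1^-1%g)] := not_far_mu1 TM oM J_core ng.
    by rewrite /= autK.
  by have [] := not_far_mu1 TM oM J_core nh.
set a := gh true; set b := gh false.
(* Facts about [u p] are translated by [w p] into facts about the pair. For the product, g h x and y
   become h x and g^-1 y. *)
have cvg_to (u : aut J * aut J -> aut J) (k : aut J)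
    (s : (unit * J) + J -> (bool * J) + J) (w : aut J * aut J -> aut J) (w' : aut J) :
    (forall p, w p \o moved1 (u p) = moved (fun e : bool => if e then p.1^-1 else p.2)%g \o s) ->
    w' \o moved1 k = moved gh \o s -> u @ U --> k.
  move=> us ks; apply: (limit_cvg UU) => phi uphi.
  apply/(ftrue_aut w'); rewrite /ftrue compA ks.
  apply: (ghP (fact_map s phi)); apply: filterS uphi => p /(ftrue_aut (w p)).
  by rewrite /ftrue compA us.
have cvg1 : (fun p : aut J * aut J => p.1^-1)%g @ U --> a.
  apply: (cvg_to _ _ (fun z => match z with inl ex => inl (true, ex.2) | inr z => inr z end)
    (fun=> 1%g) 1%g) => [p|].
    by apply: funext => -[[]|].
  by apply: funext => -[[]|].
have cvg2 : (fun p : aut J * aut J => p.2) @ U --> b.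
  apply: (cvg_to _ _ (fun z => match z with inl ex => inl (false, ex.2) | inr z => inr z end)
    (fun=> 1%g) 1%g) => [p|].
    by apply: funext => -[[]|].
  by apply: funext => -[[]|].
have cvg3 : (fun p : aut J * aut J => p.1 * p.2)%g @ U --> (a^-1 * b)%g.
  apply: (cvg_to _ _ (fun z => match z with inl ex => inl (false, ex.2)
    | inr z => inl (true, z) end) (fun p => p.1^-1)%g a) => [p|].
    by apply: funext => -[[[] z]|z] //=; rewrite autK.
  by apply: funext => -[[[] z]|z] //=; rewrite aut_invK.
have haus := autquo_hausdorff T_tame TM oM J_core.
have cvg_pi (u : aut J * aut J -> aut J) k : u @ U --> k -> (pi \o u) @ U --> pi k.
  by move=> uk; apply: cvg_comp uk _; exact: autpi_continuous.
have Uxy (A : set (autquo J * autquo J)) : nbhs (x, y) A -> U (pp @^-1` A).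
  by move=> /UD; apply: filterS => p [].
have ax : pi a^-1%g = x.
  apply: (cvg_unique haus (F := (pi \o fst) @ U)); last first.
    by move=> V Vx; apply: (Uxy (fst @^-1` V)); exact: cvg_fst.
  apply: (cvg_pi fst).
  have : (fun p : aut J * aut J => p.1^-1^-1)%g @ U --> (a^-1)%g.
    by apply: cvg_comp cvg1 _; exact: (autV_continuous TM oM J_core).
  by under [X in X @ _]eq_fun do rewrite invgK.
have yb : pi b = y.
  apply: (cvg_unique haus (F := (pi \o snd) @ U)); last first.
    by move=> V Vy; apply: (Uxy (snd @^-1` V)); exact: cvg_snd.
  exact: (cvg_pi snd).
have : U [set p | N (pi p.1 * pi p.2)%g].
  have : (pi \o (fun p : aut J * aut J => p.1 * p.2)%g) @ U --> (x * y)%g.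
    rewrite -ax -yb -[(pi _ * pi b)%g]/(autquoM (pi a^-1%g) (pi b)) /pi autpiM.
    exact: cvg_pi.
  move=> H; have {}H : U [set p | N (pi (p.1 * p.2)%g)] := H N Nxy.
  apply: filterS H => p /=.
  by rewrite -[(pi _ * pi _)%g]/(autquoM (pi p.1) (pi p.2)) /pi autpiM.
by move=> /(filterI UT)/filter_ex[p [[]]].
Qed.

Lemma autquo_topological_group : topological_group (autquo J).
Proof. by split; [exact: autquoM_continuous|exact: autquoV_continuous]. Qed.

End QuotientGroup.

Theorem theorem3p10 (L : language) (T : theory L)
    (T_complete : complete T) (T_bounded : bounded_functions T)
    (T_cover : exists M : structure L,
       [/\ local_model T M, orbit_bounded M & finite_covers M]) :
  (* existence and uniqueness *)
  (exists J : pstruct L, is_core T J) /\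
  (forall J J' : pstruct L, is_core T J -> is_core T J' -> pisomorphic J J') /\
  forall J : pstruct L, is_core T J ->
  [/\ (* reflection *)
      forall (k : nat) (R : bppfml L k) (M : structure L),
        local_model T M -> orbit_bounded M ->
        (forall p : 'I_k -> type_space M, bsat R p) ->
        (forall p : 'I_k -> J, bsat R p),
      (* quantifier elimination *)
      (forall (n : nat) (a b : 'I_n -> J),
        (forall gamma : atom L n, asat gamma a <-> asat gamma b) <->
        (exists g : aut J, forall i, b i = g (a i))) /\
      (forall (n : nat) (phi : ppfml L n), exists Gamma : set (atom L n),
        (forall M : structure L, local_model T M ->
          forall p : 'I_n -> type_space M,
            psat phi p <-> forall gamma, Gamma gamma -> asat gamma p) /\
        (forall p : 'I_n -> J,
            psat phi p <-> forall gamma, Gamma gamma -> asat gamma p)) &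
      (* topology *)
      locally_compact_space (aut J) /\
      [/\ hausdorff_space (autquo J), locally_compact_space (autquo J) &
          topological_group (autquo J)]].
Proof.
have [M [TM oM cM]] := T_cover.
have T_tame N : local_model T N -> tame N.
  exact: (local_model_tame T_complete T_bounded TM oM cM).
split; first exact: (core_exists T_complete T_tame TM oM).
split=> [J J' cJ cJ'|J cJ]; first exact: (core_unique TM oM).
split.
- move=> k R N TN oN SN p; have [j je] := core_embeds cJ TN oN.
  have [r hr rK] := core_retract cJ TN oN je.
  have hj : phom j by move=> t q /(proj2 je).
  exact/(bsat_retract R p hj hr rK).
- split=> [n a b|n phi]; first exact: (core_orbits TM oM cJ (T_tame _ TM)).
  exact: (core_elimination TM oM cJ (T_tame _ TM)).
- split; first exact: (aut_locally_compact T_tame TM oM cJ).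
  split; first exact: (autquo_hausdorff T_tame TM oM cJ).
    exact: (autquo_locally_compact T_tame TM oM cJ).
  exact: (autquo_topological_group T_tame TM oM cJ).
Qed.
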